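(* Consider all generic configurations of eight points $1,\dots,8$ lying in convex position in $\mathbb{R}P^2$. Up to the action of $D_8$, exactly $47$ different lists $L(1,\dots,8)$ are realized by such configurations. The total number of generic lists $L(1,\dots,8)$ realized is $752=47\times 16$.
   Context: Convex position: eight points of $\mathbb{R}P^2$ lie in convex position if there is a line $L_0\subset\mathbb{R}P^2$ such that, in the affine plane $\mathbb{R}P^2\setminus L_0$, they are the vertices of a strictly convex octagon. The labels are always chosen so that $1,2,\dots,8$ is the cyclic order of the vertices along the octagon. Lists: any five of the points lie on a unique conic, which is non-degenerate; its inside is the component of its complement in $\mathbb{R}P^2$ homeomorphic to a disc, and its outside is the other component. The configuration is generic if no six of the points lie on a conic. The list $L(1,\dots,8)$ is the following information: for each of the $\binom{8}{5}=56$ conics through five of the points, and for each of the three remaining points, whether that point lies inside or outside of the conic. Two lists are equal if all these data coincide. $D_8$ is the dihedral group of order $16$ of symmetries of the octagon with consecutive vertices $1,\dots,8$; it acts on lists by relabelling the points. *)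

(* Defs.v *)
From HB Require Import structures.
From mathcomp Require Import all_boot all_order all_fingroup all_algebra.
From mathcomp Require Import all_classical all_reals all_analysis.

Set Implicit Arguments.
Unset Strict Implicit.
Unset Printing Implicit Defensive.

Import Order.TTheory GRing.Theory Num.Theory.
Import numFieldNormedType.Exports.

Local Open Scope classical_set_scope.
Local Open Scope ring_scope.

Section ProjectivePlane.
Variable R : realType.

Definition nzvec : Type := set_type [set v : 'rV[R]_3 | v != 0].
HB.instance Definition _ := Topological.on nzvec.
HB.instance Definition _ := Choice.on nzvec.

(* Equality of row spaces: u and v span the same line of R^3. *)
Definition same_line (u v : nzvec) : bool := (\val u == \val v)%MS.

Lemma same_line_refl : reflexive same_line.
Proof. by move=> u; rewrite /same_line submx_refl. Qed.

Lemma same_line_sym : symmetric same_line.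
Proof. by move=> u v; rewrite /same_line andbC. Qed.

Lemma same_line_trans : transitive same_line.
Proof.
move=> v u w /andP[uv vu] /andP[vw wv].
by rewrite /same_line (submx_trans uv vw) (submx_trans wv vu).
Qed.

Definition same_line_rel : equiv_rel nzvec :=
  EquivRel same_line same_line_refl same_line_sym same_line_trans.

Definition RP2 := {eq_quot same_line_rel}%qT.
HB.instance Definition _ := Topological.copy RP2 (quotient_topology RP2).
HB.instance Definition _ := Quotient.on RP2.

(* Homogeneous coordinates of x, for a chosen representative: everything
   below depends on them only up to a nonzero scalar. *)
Definition homog (x : RP2) : 'rV[R]_3 := \val (generic_quotient.repr x).

Definition linform (l : 'cV[R]_3) (x : RP2) : R := (homog x *m l) 0 0.

Definition line (l : 'cV[R]_3) : set RP2 := [set x | linform l x = 0].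

Definition conic_of (A : 'M[R]_3) : set RP2 :=
  [set x | (homog x *m A *m (homog x)^T) 0 0 = 0].

Definition is_conic (C : set RP2) : Prop :=
  exists A : 'M[R]_3, [/\ A^T = A, A != 0 & C = conic_of A].

Definition homeomorphic (X Y : topologicalType) : Prop :=
  exists (f : X -> Y) (g : Y -> X),
    [/\ continuous f, continuous g, cancel f g & cancel g f].

Definition disc : set 'rV[R]_2 := [set u : 'rV[R]_2 | u 0 0 ^+ 2 + u 0 1 ^+ 2 < 1].

(* The connected component of x in the complement of C is a disc. *)
Definition inside (C : set RP2) : set RP2 :=
  [set x | ~ C x /\
     homeomorphic (set_type (connected_component (~` C) x)) (set_type disc)].

(* The functions linform a / linform l, for a : 'cV_3, are the affine functions
   on the affine plane complementary to line l.  The octagon with consecutive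
   vertices P 0, ..., P 7 is strictly convex when each side P i P (i + 1) lies on
   a line having the six other vertices strictly on one side. *)
Definition strictly_convex_octagon (l : 'cV[R]_3) (P : 'I_8 -> RP2) : Prop :=
  (forall i, ~ line l (P i)) /\
  (forall i, exists a : 'cV[R]_3,
     [/\ linform a (P i) = 0, linform a (P (ordS i)) = 0 &
         forall j, j != i -> j != ordS i ->
           0 < linform a (P j) / linform l (P j)]).

Definition convex_position (P : 'I_8 -> RP2) : Prop :=
  exists l : 'cV[R]_3, l != 0 /\ strictly_convex_octagon l P.

Definition generic (P : 'I_8 -> RP2) : Prop :=
  forall (C : set RP2) (S : {set 'I_8}), is_conic C -> #|S| = 6%N ->
    ~ (forall i, i \in S -> C (P i)).

End ProjectivePlane.

(* An entry of a list: five labels (those on the conic) and one of the three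
   remaining labels. *)
Definition query : finType :=
  {x : {set 'I_8} * 'I_8 | (#|x.1| == 5%N) && (x.2 \notin x.1)}.

(* true stands for "inside", false for "outside". *)
Definition plist : finType := {ffun query -> bool}.

(* The conic C below is unique when P is in convex position. *)
Definition list_of (R : realType) (P : 'I_8 -> RP2 R) : plist :=
  [ffun x : query => `[< exists C : set (RP2 R),
     [/\ is_conic C, forall i, i \in (\val x).1 -> C (P i)
       & inside C (P (\val x).2)] >]].

Definition realized (R : realType) : {set plist} :=
  [set L : plist | `[< exists P : 'I_8 -> RP2 R,
     [/\ convex_position P, generic P & list_of P = L] >]]%SET.

Lemma query_perm_subproof (s : 'S_8) (x : query) :
  (#|s @: (\val x).1| == 5%N) && (s (\val x).2 \notin s @: (\val x).1).
Proof.
by rewrite card_imset ?mem_imset; [exact: valP x|exact: perm_inj..].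
Qed.

Definition query_perm (s : 'S_8) (x : query) : query :=
  Sub (s @: (\val x).1, s (\val x).2) (query_perm_subproof s x).

(* Renaming each point i as s i. *)
Definition relabel (L : plist) (s : 'S_8) : plist :=
  [ffun x => L (query_perm s^-1 x)].

Lemma query_perm1 x : query_perm 1 x = x.
Proof.
apply: val_inj; case: x => -[S p] /= _; rewrite perm1; congr (_, _).
by rewrite (eq_imset _ (@perm1 _)) imset_id.
Qed.

Lemma query_permM s t x : query_perm (s * t) x = query_perm t (query_perm s x).
Proof.
apply: val_inj; rewrite /= permM -imset_comp; congr (_, _).
by apply: eq_imset => i; rewrite permM.
Qed.

Lemma relabel_is_action : is_action [set: 'S_8]%SET relabel.
Proof.
apply: is_total_action => [L|L s t]; apply/ffunP => x; rewrite !ffunE.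
  by rewrite invg1 query_perm1.
by rewrite invMg query_permM.
Qed.

Canonical relabel_action := Action relabel_is_action.

(* Generated by the rotation i |-> i + 1 (mod 8) and the reflection
   i |-> 7 - i. *)
Definition D8 : {group 'S_8} :=
  <<[set perm (can_inj (@ordSK 8)); perm (@rev_ord_inj 8)]%SET>>%G.

(* Main.v *)
From Stdlib Require Import BinInt.
Require Import Defs.
From mathcomp Require Import all_boot all_order all_fingroup all_algebra.
From mathcomp Require Import all_classical all_reals all_analysis.
From mathcomp Require Import cyclic ring lra ssrZ zify.

Set Implicit Arguments.
Unset Strict Implicit.
Unset Printing Implicit Defensive.

Import Order.TTheory GRing.Theory Num.Theory.
Import numFieldNormedType.Exports.


(** A list turns out to be a pattern of twenty-eight signs, and the theorem a
    statement about which patterns occur.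

    Represent the points by vectors u_0, ..., u_7 of R^3 and write [ijk] for the
    determinant of u_i, u_j, u_k.  Convex position, with the labels in cyclic
    order, means that the vectors can be chosen so that [ijk] > 0 for all
    i < j < k ([positive_of_convex], [convex_of_positive]).  Six points lie on a
    conic exactly when an alternating polynomial [six] in the brackets vanishes,
    and for a < b < c < d < e the point p is inside the conic abcde exactly when
    six a b c d e p < 0 ([inside_through_five]).  As [six] is alternating, a list
    amounts to the signs of [six] on the 28 increasing 6-tuples of labels
    ([list_ofE]).

    Upper bound.  For seven points, six a b c d x y is the determinant
    q(x) r(y) - r(x) q(y), where q and r are the pairs of lines ab, cd and ac, bd;
    hence the three-term relation [six_relation]
      q(e) six(abcdfg) - q(f) six(abcdeg) + q(g) six(abcdef) = 0.
    The signs of q(e), q(f), q(g) are known from positivity of the brackets, so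
    each relation says that three known sign changes of three of the 28 signs are
    not all equal.  These conditions, for all choices of a, ..., g, already leave
    only 752 patterns ([size_search], by exhaustive search).

    Lower bound.  Forty-seven octagons with integer coordinates between 0 and 11,
    each relabelled by the sixteen dihedral symmetries, give 752 different
    patterns ([all_signs_distinct]).  So exactly these 752 lists are realized
    ([realizedE]).  They lie in the orbits of 47 of them, and as D8 has at most 16
    elements fewer than 47 orbits could not contain them all.

    It remains to compare the topological definition of the inside with a sign.
    In suitable coordinates the conic is x^2 + y^2 = z^2.  The points with
    x^2 + y^2 < z^2 form an open disc ([inside_cone_neg]).  The others form a
    Moebius band: through each of them passes a loop along which a nonzero vector
    cannot be followed continuously and come back to itself, whereas in a disc
    every loop can be contracted and therefore lifts to a closed path of nonzero
    vectors ([not_inside_cone_pos]). *)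

Local Open Scope classical_set_scope.
Local Open Scope ring_scope.

(** * Homogeneous coordinates on the projective plane *)

Section Topology.
Variable R : realType.
Implicit Types (v w : 'rV[R]_3) (x y : RP2 R).

Definition proj_point v (v0 : v != 0) : RP2 R :=
  (\pi_(RP2 R) (exist _ v (mem_set v0) : nzvec R))%qT.

Lemma homog_neq0 x : homog x != 0.
Proof. by rewrite /homog; case: (generic_quotient.repr x) => v /= /set_mem. Qed.

Lemma same_lineP (a b : nzvec R) :
  reflect (exists2 k : R, k != 0 & \val a = k *: \val b) (same_line a b).
Proof.
rewrite /same_line; apply: (iffP idP).
  case/andP => /sub_rVP [k ak] _; exists k => //.
  by apply/eqP => k0; have /= := set_mem (valP a); rewrite ak k0 scale0r eqxx.
case=> k k0 ->; apply/andP; split; first exact: scalemx_sub.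
by rewrite -[X in (X <= _)%MS]scale1r -(mulVf k0) -scalerA scalemx_sub.
Qed.

Lemma homog_proj_point v (v0 : v != 0) :
  exists2 k, k != 0 & homog (proj_point v0) = k *: v.
Proof.
have /eqmodP /same_lineP [k k0 e] :
    generic_quotient.repr (proj_point v0) = exist _ v (mem_set v0) %[mod RP2 R]%qT.
  by rewrite reprK.
by exists k.
Qed.

Lemma proj_point_homog x v (v0 : v != 0) k : homog x = k *: v -> x = proj_point v0.
Proof.
move=> e; rewrite -[x]reprK; apply/eqmodP/same_lineP; exists k => //.
apply: contraNneq (homog_neq0 x) => k0.
by rewrite e k0 scale0r.
Qed.

(** The topology on row vectors is the product topology of the entries. *)
Lemma rV_continuous_at (T : topologicalType) n (h : T -> 'rV[R]_n) t :
  (forall j, {for t, continuous (fun s => h s 0 j)}) -> {for t, continuous h}.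
Proof.
move=> hc A [P Pn PA].
have : \forall s \near t, forall j, P 0 j (h s 0 j).
  by apply: filter_forall => j; exact: (hc j).
by apply: filterS => s Ps; apply: PA => i j; rewrite (ord1 i); exact: Ps.
Qed.

Lemma rV_continuous (T : topologicalType) n (h : T -> 'rV[R]_n) :
  (forall j, continuous (fun t => h t 0 j)) -> continuous h.
Proof. by move=> hc t; apply: rV_continuous_at => j; exact: hc. Qed.

Lemma cont_proj_point (T : topologicalType) (h : T -> 'rV[R]_3)
  (h0 : forall t, h t != 0) : continuous h -> continuous (fun t => proj_point (h0 t)).
Proof.
move=> hc.
pose h' t : nzvec R := exist _ (h t) (mem_set (h0 t)).
have ch' : continuous h'.
  apply: continuous_comp_initial; exact: hc.
move=> t; apply: (@continuous_comp _ _ _ h' (\pi_(RP2 R))%qT); first exact: ch'.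
exact: pi_continuous.
Qed.

(** Continuous functions on the quotient come from functions on nonzero vectors that
    are constant on lines; only continuity away from 0 can be asked, since degree-0
    homogeneous functions are singular there. *)
Lemma cont_homog (Z : topologicalType) (g : 'rV[R]_3 -> Z) :
  (forall v, v != 0 -> {for v, continuous g}) ->
  (forall k v, k != 0 -> g (k *: v) = g v) ->
  continuous (fun x => g (homog x)).
Proof.
move=> gc gk.
pose g' (a : nzvec R) := g (\val a).
have -> : (fun x => g (homog x)) = g' \o (@generic_quotient.repr _ (RP2 R)) by [].
apply: repr_comp_continuous.
  move=> a; apply: continuous_comp; first exact: initial_continuous.
  by apply: gc; apply/set_mem/(valP a).
by move=> a b /eqP/eqmodP/same_lineP [k k0 e]; apply/eqP; rewrite /g' e gk.
Qed.

End Topology.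

(** * Continuous maps and the standard quadratic cone *)

Lemma cont_comp (S T U : topologicalType) (f : S -> T) (g : T -> U) :
  continuous f -> continuous g -> continuous (fun s => g (f s)).
Proof. by move=> cf cg s; apply: continuous_comp; [exact: cf|exact: cg]. Qed.

Lemma cont_pair (S T U : topologicalType) (f : S -> T) (g : S -> U) :
  continuous f -> continuous g -> continuous (fun s => (f s, g s)).
Proof.
move=> cf cg s; apply: (@cvg_pair _ _ _ _ (nbhs (f s)) (nbhs (g s)));
  [exact: cf|exact: cg].
Qed.

Lemma cont_fst (T U : topologicalType) : continuous (@fst T U).
Proof. by move=> p; exact: cvg_fst. Qed.

Lemma cont_snd (T U : topologicalType) : continuous (@snd T U).
Proof. by move=> p; exact: cvg_snd. Qed.

Lemma cont_id (T : topologicalType) : continuous (@id T).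
Proof. by move=> p; exact: cvg_id. Qed.

Lemma cont_cst (T U : topologicalType) (u : U) : continuous (fun _ : T => u).
Proof. by move=> t; exact: cvg_cst. Qed.

Section Cone.
Variable R : realType.
Implicit Types (v w : 'rV[R]_3) (x y : RP2 R).

Lemma sum_I3 (V : nmodType) (F : 'I_3 -> V) : \sum_i F i = F 0 + F 1 + F 2.
Proof.
rewrite !big_ord_recl big_ord0 addr0 addrA.
by congr (F _ + F _ + F _); apply: val_inj.
Qed.

Lemma row3_eq v w : v 0 0 = w 0 0 -> v 0 1 = w 0 1 -> v 0 2 = w 0 2 -> v = w.
Proof.
move=> e0 e1 e2; apply/rowP => -[[|[|[|//]]] lt].
- by rewrite (_ : Ordinal lt = 0) //; apply: val_inj.
- by rewrite (_ : Ordinal lt = 1) //; apply: val_inj.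
- by rewrite (_ : Ordinal lt = 2) //; apply: val_inj.
Qed.

Definition vec3 (a b c : R) : 'rV[R]_3 :=
  \row_j (if j == 0 then a else if j == 1 then b else c).

Lemma vec3E a b c : (vec3 a b c 0 0 = a) * (vec3 a b c 0 1 = b) * (vec3 a b c 0 2 = c).
Proof. by rewrite !mxE. Qed.

Lemma vec3Z k a b c : k *: vec3 a b c = vec3 (k * a) (k * b) (k * c).
Proof. by apply: row3_eq; rewrite mxE !vec3E. Qed.

Lemma vec3_eta v : v = vec3 (v 0 0) (v 0 1) (v 0 2).
Proof. by apply: row3_eq; rewrite !vec3E. Qed.

(** Every conic considered below becomes [cone = 0] after a linear change of
    coordinates. *)
Definition cone w : R := w 0 0 ^+ 2 + w 0 1 ^+ 2 - w 0 2 ^+ 2.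

Lemma coneZ k w : cone (k *: w) = k ^+ 2 * cone w.
Proof. by rewrite /cone !mxE; ring. Qed.

Lemma cont_coord (T : topologicalType) n (h : T -> 'rV[R]_n) j :
  continuous h -> continuous (fun t => h t 0 j).
Proof.
by move=> hc t; apply: (@continuous_comp _ _ _ h (fun w : 'rV_n => w 0 j));
  [exact: hc | exact: coord_continuous].
Qed.

Section ContinuousRing.
Variable T : topologicalType.
Implicit Types f g : T -> R.

Lemma contD f g : continuous f -> continuous g -> continuous (fun t => f t + g t).
Proof. by move=> cf cg t; apply: continuousD; [exact: cf|exact: cg]. Qed.

Lemma contB f g : continuous f -> continuous g -> continuous (fun t => f t - g t).
Proof. by move=> cf cg t; apply: continuousB; [exact: cf|exact: cg]. Qed.

Lemma contN f : continuous f -> continuous (fun t => - f t).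
Proof. by move=> cf t; apply: cvgN; exact: cf. Qed.

Lemma contM f g : continuous f -> continuous g -> continuous (fun t => f t * g t).
Proof. by move=> cf cg t; apply: continuousM; [exact: cf|exact: cg]. Qed.

Lemma contX f n : continuous f -> continuous (fun t => f t ^+ n).
Proof.
move=> cf t; apply: (@continuous_comp _ _ _ f (fun r => r ^+ n)); first exact: cf.
exact: exprn_continuous.
Qed.

Lemma contV f : (forall t, f t != 0) -> continuous f -> continuous (fun t => (f t)^-1).
Proof. by move=> f0 cf t; apply: continuousV; [exact: f0|exact: cf]. Qed.

End ContinuousRing.

Lemma cont_mulmx n (G : 'M[R]_(3,n)) : continuous (fun v => v *m G).
Proof.
apply: rV_continuous => j.
rewrite (_ : (fun _ => _) =
  (fun v => v 0 0 * G 0 j + v 0 1 * G 1 j + v 0 2 * G 2 j)); last first.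
  by apply/funext => v; rewrite !mxE sum_I3.
by apply: contD; first apply: contD; apply: contM;
  (exact: coord_continuous || exact: cont_cst).
Qed.

Lemma cont_cone : continuous cone.
Proof.
by apply: contB; first apply: contD; apply: contX; exact: coord_continuous.
Qed.

(** The sign of a quadratic form at a point of the projective plane does not depend on
    the representative, although its value does. *)
Lemma open_positive_form (f : 'rV[R]_3 -> R) : continuous f ->
  (forall k v, f (k *: v) = k ^+ 2 * f v) ->
  open [set x : RP2 R | 0 < f (homog x)].
Proof.
move=> fc fk.
have oN : open ((\val : nzvec R -> _) @^-1` [set v | 0 < f v]).
  have /continuousP vc : continuous (\val : nzvec R -> 'rV[R]_3).
    exact: initial_continuous.
  apply: vc; apply: (@open_comp _ _ f [set r | 0 < r]); first by move=> v _; exact: fc.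
  exact: open_gt.
rewrite /open /= /quotient_open.
rewrite (_ : _ @^-1` _ = (\val : nzvec R -> _) @^-1` [set v | 0 < f v]) //.
have piE (a : nzvec R) : (\pi_(RP2 R) a)%qT = proj_point (set_mem (valP a)).
  by rewrite /proj_point; congr (\pi_ _ _)%qT; apply: val_inj.
apply/seteqP; split=> a /=; rewrite piE;
  have [k k0 ->] := homog_proj_point (set_mem (valP a));
  by rewrite fk pmulr_rgt0 // exprn_even_gt0.
Qed.
End Cone.

(** * The inside of a conic is a disc *)

Lemma connected_sub_open (T : topologicalType) (K A B : set T) :
  connected K -> open A -> open B -> A `&` B = set0 -> K `<=` A `|` B ->
  K `&` A !=set0 -> K `<=` A.
Proof.
move=> Kc oA oB AB KAB KA; rewrite -(Kc _ KA); first by move=> x [].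
  by exists A.
exists (~` B); first exact: open_closedC.
apply/seteqP; split=> x [Kx]; last by move=> nB; split=> //; case: (KAB _ Kx).
by move=> Ax; split=> // Bx; have : (A `&` B) x by []; rewrite AB.
Qed.

Section InsideCone.
Variables (R : realType) (G : 'M[R]_3).
Hypothesis Gu : G \in unitmx.
Implicit Types (v w : 'rV[R]_3) (x y : RP2 R) (u : 'rV[R]_2).

Lemma mulmx_unit_eq0 v : (v *m G == 0) = (v == 0).
Proof.
apply/eqP/eqP => [e|->]; last by rewrite mul0mx.
by rewrite -[v](mulmxK Gu) e mul0mx.
Qed.

Let q x := cone (homog x *m G).
Let N := [set x | q x < 0].
Let P := [set x | 0 < q x].

Lemma open_outer : open P.
Proof.
apply: (@open_positive_form _ (fun v => cone (v *m G))); last first.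
  by move=> k v; rewrite -scalemxAl coneZ.
exact: (cont_comp (@cont_mulmx R 3 G) (@cont_cone R)).
Qed.

Lemma open_inner : open N.
Proof.
rewrite (_ : N = [set x | 0 < - cone (homog x *m G)]); last first.
  by apply/seteqP; split=> x /=; rewrite oppr_gt0.
apply: (@open_positive_form _ (fun v => - cone (v *m G))); last first.
  by move=> k v; rewrite -scalemxAl coneZ mulrN.
by apply: contN; exact: (cont_comp (@cont_mulmx R 3 G) (@cont_cone R)).
Qed.

Definition chart_vec u := vec3 (u 0 0) (u 0 1) 1 *m invmx G.

Lemma chart_vec_neq0 u : chart_vec u != 0.
Proof.
rewrite -mulmx_unit_eq0 mulmxKV //; apply/eqP => /(congr1 (fun w => w 0 2)).
by rewrite vec3E mxE => /eqP; rewrite oner_eq0.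
Qed.

(** The affine chart z = 1; it maps the unit disc onto the negative side of the cone. *)
Definition chart u : RP2 R := proj_point (chart_vec_neq0 u).

Lemma cont_chart : continuous chart.
Proof.
apply: cont_proj_point.
apply: (@cont_comp _ _ _ (fun u => vec3 (u 0 0) (u 0 1) 1) (mulmx^~ (invmx G)));
  last exact: cont_mulmx.
apply: rV_continuous => j; rewrite (_ : (fun _ => _) = (fun u =>
    if j == 0 then u 0 0 else if j == 1 then u 0 1 else 1)); last first.
  by apply/funext => w; rewrite mxE.
by case: (j == 0); [|case: (j == 1)]; (exact: coord_continuous || exact: cont_cst).
Qed.

Lemma chartP u : exists2 k, k != 0 & homog (chart u) *m G = k *: vec3 (u 0 0) (u 0 1) 1.
Proof.
have [k k0 e] := homog_proj_point (chart_vec_neq0 u).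
by exists k => //; rewrite /chart e -scalemxAl mulmxKV.
Qed.

Lemma chart_inner u : disc u -> N (chart u).
Proof.
rewrite /disc /N /q /= => du; have [k k0 ->] := chartP u.
by rewrite coneZ pmulr_rlt0 ?exprn_even_gt0 // /cone !vec3E expr1n subr_lt0.
Qed.

Let den w : R := Num.max (w 0 2 ^+ 2) (w 0 0 ^+ 2 + w 0 1 ^+ 2).
Definition unchart_vec w : 'rV[R]_2 :=
  \row_j ((if j == 0 then w 0 0 else w 0 1) * w 0 2 / den w).
(** The inverse chart is (x, y) / z, that is (x z, y z) / z^2.  Replacing z^2 by
    max(z^2, x^2 + y^2) changes nothing on the negative side of the cone and makes
    the formula continuous on the whole projective plane, so that no partial
    continuity has to be handled. *)
Definition unchart x := unchart_vec (homog x *m G).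

Lemma den_gt0 w : w != 0 -> 0 < den w.
Proof.
move=> w0; rewrite lt_max -implyNb -leNgt; apply/implyP => h.
have w2 : w 0 2 = 0 by apply/eqP; rewrite -sqrf_eq0 eq_le h sqr_ge0.
rewrite lt_neqAle addr_ge0 ?sqr_ge0 // andbT eq_sym paddr_eq0 ?sqr_ge0 //.
apply: contra w0; rewrite !sqrf_eq0 => /andP[/eqP e0 /eqP e1].
by apply/eqP/row3_eq; rewrite !mxE.
Qed.

Lemma cont_unchart : continuous unchart.
Proof.
apply: (@cont_homog _ _ (fun v => unchart_vec (v *m G))); last first.
  move=> k v k0; apply/rowP => j; rewrite -scalemxAl !mxE /den !mxE.
  rewrite !exprMn -mulrDr -maxr_pMr ?sqr_ge0 //.
  set d := Num.max _ _.
  have k2 : k ^+ 2 != 0 by rewrite sqrf_eq0.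
  by case: ifP => _; rewrite mulrACA -expr2 invfM mulrACA divff // mul1r.
move=> v v0.
have vG : v *m G != 0 by rewrite mulmx_unit_eq0.
apply: (@continuous_comp _ _ _ (mulmx^~ G : 'rV_3 -> 'rV_3)); first exact: cont_mulmx.
move: (v *m G) vG => w w0.
have c2 : continuous (fun z : 'rV[R]_3 => z 0 2 ^+ 2).
  by apply: contX; exact: coord_continuous.
have c01 : continuous (fun z : 'rV[R]_3 => z 0 0 ^+ 2 + z 0 1 ^+ 2).
  by apply: contD; apply: contX; exact: coord_continuous.
have cden : {for w, continuous den} := continuous_max (c2 w) (c01 w).
apply: rV_continuous_at => j.
rewrite (_ : (fun _ => _) = (fun z : 'rV[R]_3 =>
    (if j == 0 then z 0 0 else z 0 1) * z 0 2 / den z)); last first.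
  by apply/funext => z; rewrite mxE.
have cnum : continuous (fun z : 'rV[R]_3 =>
    (if j == 0 then z 0 0 else z 0 1) * z 0 2).
  apply: contM; last exact: coord_continuous.
  by case: (j == 0); exact: coord_continuous.
apply: continuousM; first exact: cnum.
by apply: continuousV => //; rewrite gt_eqF // den_gt0.
Qed.

Lemma row2_eq u u' : u 0 0 = u' 0 0 -> u 0 1 = u' 0 1 -> u = u'.
Proof.
move=> e0 e1; apply/rowP => -[[|[|//]] lt].
- by rewrite (_ : Ordinal lt = 0) //; apply: val_inj.
- by rewrite (_ : Ordinal lt = 1) //; apply: val_inj.
Qed.

Lemma unchart_inner x : N x ->
  [/\ (homog x *m G) 0 2 != 0,
   unchart x 0 0 = (homog x *m G) 0 0 / (homog x *m G) 0 2 &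
   unchart x 0 1 = (homog x *m G) 0 1 / (homog x *m G) 0 2].
Proof.
rewrite /N /q /unchart /=; move: (homog x *m G) => w; rewrite /cone subr_lt0 => h.
have w2 : w 0 2 != 0.
  rewrite -sqrf_eq0 gt_eqF //; apply: le_lt_trans h.
  by rewrite addr_ge0 // sqr_ge0.
have dE : den w = w 0 2 ^+ 2 by apply/max_idPl/ltW.
by split=> //; rewrite mxE /= dE expr2 invfM mulrA mulfK.
Qed.

Lemma unchart_disc x : N x -> disc (unchart x).
Proof.
move=> Nx; have [w2 e0 e1] := unchart_inner Nx.
rewrite /disc /= e0 e1 !expr_div_n -mulrDl ltr_pdivrMr ?exprn_even_gt0 // mul1r.
by rewrite -subr_lt0.
Qed.

Lemma unchartK x : N x -> chart (unchart x) = x.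
Proof.
move=> Nx; have [w2 e0 e1] := unchart_inner Nx.
apply/esym; apply: (@proj_point_homog _ _ _ _ ((homog x *m G) 0 2)).
apply: (can_inj (mulmxK Gu)); rewrite -scalemxAl mulmxKV //.
by apply: row3_eq; rewrite [in RHS]mxE vec3E ?e0 ?e1 ?mulr1 // mulrCA divff ?mulr1.
Qed.

Lemma chartK u : disc u -> unchart (chart u) = u.
Proof.
move=> /chart_inner /unchart_inner [w2 e0 e1].
have [k k0 e] := chartP u.
by apply: row2_eq; rewrite ?e0 ?e1 e vec3Z !vec3E mulr1 mulrAC divff ?mul1r.
Qed.

Lemma homeo_inner : homeomorphic (set_type N) (set_type (@disc R)).
Proof.
have fP (y : set_type N) : unchart (\val y) \in @disc R.
  by apply/mem_set/unchart_disc/set_mem/(valP y).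
have gP (u : set_type (@disc R)) : chart (\val u) \in N.
  by apply/mem_set/chart_inner/set_mem/(valP u).
exists (fun y : set_type N => exist _ (unchart (\val y)) (fP y)).
exists (fun u : set_type (@disc R) => exist _ (chart (\val u)) (gP u)).
split.
- apply: continuous_comp_initial.
  exact: (cont_comp (@initial_continuous _ _ _) cont_unchart).
- apply: continuous_comp_initial.
  exact: (cont_comp (@initial_continuous _ _ _) cont_chart).
- by move=> y; apply: val_inj => /=; apply/unchartK/set_mem/(valP y).
- by move=> y; apply: val_inj => /=; apply/chartK/set_mem/(valP y).
Qed.

(** The chart sends the radii of the disc to connected sets with a common point. *)
Lemma connected_inner : connected N.
Proof.
have -> : N = \bigcup_(u in @disc R) [set chart (t *: u) | t in `[0, 1]].
  apply/seteqP; split=> [x Nx|x [u du [t]]] /=.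
    exists (unchart x); first exact: unchart_disc.
    by exists 1; rewrite ?scale1r ?unchartK //= in_itv /= ler01 lexx.
  rewrite /= in_itv /= => /andP[t0 t1] <-; apply: chart_inner.
  rewrite /disc /= !mxE !exprMn -mulrDr.
  apply: le_lt_trans du; rewrite ler_piMl ?addr_ge0 ?sqr_ge0 //.
  by rewrite expr_le1.
apply: bigcup_connected.
  exists (chart 0) => u du; exists 0; last by rewrite scale0r.
  by rewrite /= in_itv /= ler01 lexx.
move=> u du; apply: connected_continuous_connected; first exact: segment_connected.
apply: continuous_subspaceT.
by apply: (cont_comp _ cont_chart); exact: scalel_continuous.
Qed.

(** The two sides of the cone are open and cover the complement of the conic, so the
    component of a point of the negative side is the whole negative side. *)
Lemma inside_cone_neg x : N x -> inside [set y | q y = 0] x.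
Proof.
move=> Nx; split; first by move=> /= e; move: Nx; rewrite /N /= e ltxx.
suff -> : connected_component (~` [set y | q y = 0]) x = N by exact: homeo_inner.
apply/seteqP; split.
  have Kc := @component_connected _ (~` [set y | q y = 0]) x.
  refine (connected_sub_open Kc open_inner open_outer _ _ _).
  - apply/seteqP; split=> // y [] ; rewrite /N /P /= => h1 h2.
    by have := lt_trans h1 h2; rewrite ltxx.
  - move=> y /connected_component_sub /= /eqP; rewrite neq_lt => /orP[]; by [left|right].
  - exists x; split=> //; apply: connected_component_refl => /= e.
    by move: Nx; rewrite /N /= e ltxx.
apply: connected_component_max => //; last exact: connected_inner.
by move=> y; rewrite /N /= => h e; rewrite e ltxx in h.
Qed.

End InsideCone.

(** * The outside of a conic is not a disc *)

Section OutsideCone.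
Variables (R : realType).
Implicit Types (v w : 'rV[R]_3) (x y : RP2 R).

Definition dot v w : R := v 0 0 * w 0 0 + v 0 1 * w 0 1 + v 0 2 * w 0 2.

Lemma dotC v w : dot v w = dot w v.
Proof. by rewrite /dot; ring. Qed.

Lemma dotZl k v w : dot (k *: v) w = k * dot v w.
Proof. by rewrite /dot !mxE; ring. Qed.

Lemma dotZr k v w : dot v (k *: w) = k * dot v w.
Proof. by rewrite dotC dotZl dotC. Qed.

Lemma dot_gt0 v : v != 0 -> 0 < dot v v.
Proof.
move=> v0; rewrite lt_neqAle /dot -!expr2 !addr_ge0 ?sqr_ge0 // andbT eq_sym.
apply: contra v0; rewrite !paddr_eq0 ?addr_ge0 ?sqr_ge0 // !sqrf_eq0.
by move=> /andP[/andP[/eqP e0 /eqP e1] /eqP e2]; apply/eqP/row3_eq; rewrite ?mxE.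
Qed.

Lemma cont_dot (T : topologicalType) (f g : T -> 'rV[R]_3) :
  continuous f -> continuous g -> continuous (fun t => dot (f t) (g t)).
Proof.
by move=> cf cg; apply: contD; first apply: contD; apply: contM; exact: cont_coord.
Qed.

(** An entry of the matrix of the orthogonal projection onto the line x. *)
Definition proj_entry i j x : R := homog x 0 i * homog x 0 j / dot (homog x) (homog x).

Lemma cont_proj_entry i j : continuous (proj_entry i j).
Proof.
apply: (@cont_homog _ _ (fun v => v 0 i * v 0 j / dot v v)); last first.
  move=> k v k0; rewrite dotZl dotZr !mxE.
  have [->|v0] := eqVneq (dot v v) 0; first by rewrite !mulr0 !invr0 !mulr0.
  by field; rewrite k0 v0.
move=> v v0; apply: continuousM.
  have c : continuous (fun v => v 0 i * v 0 j).
    by apply: contM; exact: coord_continuous.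
  exact: c.
apply: continuousV; first by rewrite gt_eqF // dot_gt0.
have c : continuous (fun v => dot v v) by apply: cont_dot => w; exact: cvg_id.
exact: c.
Qed.

(** The squared cosine of the angle between two lines, as the trace of the product of
    the two orthogonal projections: each projection entry is continuous on the
    projective plane, so this is too. *)
Definition cos2 x y : R := \sum_i \sum_j proj_entry i j x * proj_entry i j y.

Lemma cos2E x y : cos2 x y = dot (homog x) (homog y) ^+ 2 /
  (dot (homog x) (homog x) * dot (homog y) (homog y)).
Proof.
rewrite /cos2 !sum_I3 /proj_entry.
have := dot_gt0 (homog_neq0 x); have := dot_gt0 (homog_neq0 y).
rewrite /dot => hx hy; field.
by rewrite !gt_eqF.
Qed.

Lemma cont_cos2 (T : topologicalType) (f g : T -> RP2 R) :
  continuous f -> continuous g -> continuous (fun t => cos2 (f t) (g t)).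
Proof.
move=> cf cg; rewrite (_ : (fun _ => _) = (fun t =>
  \sum_i \sum_j proj_entry i j (f t) * proj_entry i j (g t))) //.
rewrite (_ : (fun _ => _) = (fun t =>
   (proj_entry 0 0 (f t) * proj_entry 0 0 (g t) +
    proj_entry 0 1 (f t) * proj_entry 0 1 (g t) +
    proj_entry 0 2 (f t) * proj_entry 0 2 (g t)) +
   (proj_entry 1 0 (f t) * proj_entry 1 0 (g t) +
    proj_entry 1 1 (f t) * proj_entry 1 1 (g t) +
    proj_entry 1 2 (f t) * proj_entry 1 2 (g t)) +
   (proj_entry 2 0 (f t) * proj_entry 2 0 (g t) +
    proj_entry 2 1 (f t) * proj_entry 2 1 (g t) +
    proj_entry 2 2 (f t) * proj_entry 2 2 (g t))));
  last first.
  by apply/funext => t; rewrite !sum_I3.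
by do ! (apply: contD); apply: contM; apply: (cont_comp _ (@cont_proj_entry _ _)).
Qed.

Section Lift.
Variable H : R -> R -> RP2 R.
Hypothesis Hc : continuous (fun p : R * R => H p.1 p.2).
Hypothesis H01 : forall t, H t 0 = H t 1.

(** The loop u |-> H t u of lines carries a continuous nonzero vector field that closes
    up; equivalently, the loop is null-homotopic, but this form is preserved under
    homotopy by an elementary argument. *)
Definition lifts t := exists s : R -> 'rV[R]_3,
  [/\ continuous s, s 0 = s 1 &
    forall u, u \in `[0, 1] -> exists2 k, k != 0 & s u = k *: homog (H t u)].

Definition nonorthogonal t t' := forall u, u \in `[0, 1] ->
  dot (homog (H t u)) (homog (H t' u)) != 0.

(** A lift of one loop is projected orthogonally onto the lines of the other; the
    result does not vanish because the lines are not orthogonal. *)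
Lemma lifts_nonorthogonal t t' : nonorthogonal t t' -> lifts t -> lifts t'.
Proof.
move=> cl [s [sc s01 sk]].
pose s' u : 'rV[R]_3 := \row_j (s u 0 0 * proj_entry 0 j (H t' u) +
  s u 0 1 * proj_entry 1 j (H t' u) + s u 0 2 * proj_entry 2 j (H t' u)).
have s'E u : s' u = (dot (s u) (homog (H t' u)) /
    dot (homog (H t' u)) (homog (H t' u))) *: homog (H t' u).
  apply/rowP => j; rewrite !mxE /proj_entry /dot; ring.
have Htc : continuous (H t').
  exact: (cont_comp (cont_pair (@cont_cst _ _ t') (@cont_id _)) Hc).
exists s'; split.
- apply: rV_continuous => j; rewrite (_ : (fun _ => _) = fun u =>
    s u 0 0 * proj_entry 0 j (H t' u) + s u 0 1 * proj_entry 1 j (H t' u) +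
    s u 0 2 * proj_entry 2 j (H t' u)); last by apply/funext => u; rewrite mxE.
  apply: contD; first apply: contD; apply: contM; try exact: cont_coord;
  exact: (cont_comp Htc (@cont_proj_entry _ _)).
- by rewrite !s'E s01 H01.
move=> u u01; rewrite s'E; eexists; last by reflexivity.
have [k k0 ->] := sk u u01.
rewrite dotZl mulf_neq0 ?invr_eq0 ?mulf_neq0 //; first exact: cl.
by rewrite gt_eqF // dot_gt0 // homog_neq0.
Qed.

Lemma nonorthogonalC t t' : nonorthogonal t t' -> nonorthogonal t' t.
Proof. by move=> cl u u01; rewrite dotC; exact: cl. Qed.

(** A line is not orthogonal to itself, and compactness of [0, 1] makes the
    neighbourhoods uniform along the loop. *)
Lemma near_nonorthogonal t : \forall t' \near t, nonorthogonal t t'.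
Proof.
have /compact_near_coveringP nc := @segment_compact R 0 1.
have := nc R (nbhs t) (fun t' u => 0 < cos2 (H t u) (H t' u)) _.
move=> /(_ _) h.
have {}h : \forall t' \near t, `[0,1]%classic `<=` (fun u => 0 < cos2 (H t u) (H t' u)).
  apply: h => u _.
  have cc : continuous (fun p : R * R => cos2 (H t p.1) (H p.2 p.1)).
    apply: cont_cos2.
      exact: (cont_comp (cont_pair (@cont_cst _ _ t) (@cont_fst _ _)) Hc).
    exact: (cont_comp (cont_pair (@cont_snd _ _) (@cont_fst _ _)) Hc).
  have c0 : 0 < cos2 (H t u) (H t u).
    have d0 := dot_gt0 (homog_neq0 (H t u)).
    by rewrite cos2E divr_gt0 ?exprn_gt0 ?mulr_gt0.
  have := cc (u, t) [set r | 0 < r] (open_nbhs_nbhs (conj (@open_gt _ _) c0)).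
  by [].
apply: filterS h => t' h u u01; have := h u u01.
rewrite cos2E; apply: contraTneq => ->.
by rewrite expr0n /= mul0r ltxx.
Qed.

(** By the two previous lemmas, liftability is an open and closed condition on the
    parameter of a homotopy. *)
Lemma lifts_all : lifts 0 -> lifts 1.
Proof.
move=> l0.
have oL : open [set t | lifts t].
  rewrite openE => t lt; apply: filterS (near_nonorthogonal t) => t'.
  by move/lifts_nonorthogonal; exact.
have oN : open [set t | ~ lifts t].
  rewrite openE => t lt; apply: filterS (near_nonorthogonal t) => t'.
  move=> /nonorthogonalC cl l.
  by apply: lt; exact: lifts_nonorthogonal cl l.
have cT : connected (@setT R) by apply/connected_intervalP.
suff : setT `<=` [set t | lifts t] by apply.
refine (connected_sub_open cT oL oN _ _ _).
- by apply/seteqP; split=> // t [].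
- by move=> t _; have [l|l] := pselect (lifts t); [left|right].
- by exists 0.
Qed.
End Lift.

Variable G : 'M[R]_3.
Hypothesis Gu : G \in unitmx.

(** The positive side of the cone is not simply connected.  If a component of it were
    a disc, the loop below could be contracted to a point inside that disc, hence
    would lift to a closed path of nonzero vectors; but following a vector along it
    leads to the opposite vector. *)
Lemma not_inside_cone_pos x : 0 < cone (homog x *m G) ->
  ~ inside [set y | cone (homog y *m G) = 0] x.
Proof.
move=> x0 [_ [f [g [fc gc fK _]]]].
set K := connected_component _ _ in f g fc gc fK.
pose a := (homog x *m G) 0 0; pose b := (homog x *m G) 0 1.
pose c := (homog x *m G) 0 2.
have abc : 0 < a ^+ 2 + b ^+ 2 - c ^+ 2 by exact: x0.
(* In the coordinates of the cone, the point (a, b, c) moves along a straight line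
   to (-a, -b, -c), with a detour orthogonal to (a, b) that keeps the form positive
   also for u = 1/2; this holds for all real u, which spares restrictions to
   [0, 1]. *)
pose e (u : R) := vec3 ((1 - 2 * u) * a - 4 * u * (1 - u) * b)
   ((1 - 2 * u) * b + 4 * u * (1 - u) * a) ((1 - 2 * u) * c).
pose h u := e u *m invmx G.
have hc u : 0 < cone (h u *m G).
  rewrite /h mulmxKV // /cone !vec3E.
  rewrite (_ : _ - _ = (1 - 2 * u) ^+ 2 * (a ^+ 2 + b ^+ 2 - c ^+ 2) +
    (4 * u * (1 - u)) ^+ 2 * (a ^+ 2 + b ^+ 2)); last by ring.
  have ab : 0 < a ^+ 2 + b ^+ 2 by have := sqr_ge0 c; lra.
  have [->|u0] := eqVneq u 0.
    by rewrite !mulr0 subr0 mul0r expr1n mul1r expr0n mul0r addr0.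
  have [->|u1] := eqVneq u 1.
    by rewrite subrr mulr0 expr0n mul0r addr0 mulr1 mulr_gt0 //; lra.
  apply: ltr_wpDl; first by rewrite mulr_ge0 ?sqr_ge0 // ltW.
  rewrite mulr_gt0 // exprn_even_gt0 //= !mulf_neq0 // ?pnatr_eq0 //.
  by rewrite subr_eq0 eq_sym.
have h0 u : h u != 0.
  apply/eqP => hu; have := hc u; rewrite hu mul0mx /cone !mxE; lra.
have oppE w j : (- w) 0 j = - w 0 j by rewrite mxE.
have eE : e 0 = homog x *m G /\ e 1 = - (homog x *m G).
  by split; apply: row3_eq; rewrite ?oppE !vec3E -/a -/b -/c; ring.
have hx0 : h 0 = homog x by rewrite /h eE.1 mulmxK.
have hx1 : h 1 = - homog x by rewrite /h eE.2 mulNmx mulmxK.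
pose loop u := proj_point (h0 u).
have loop0 : loop 0 = x.
  by apply/esym/(@proj_point_homog _ _ _ _ 1); rewrite hx0 scale1r.
have loop1 : loop 1 = x.
  by apply/esym/(@proj_point_homog _ _ _ _ (-1)); rewrite hx1 scaleN1r opprK.
have h_cont : continuous h.
  apply: (@cont_comp _ _ _ e (mulmx^~ (invmx G))); last exact: cont_mulmx.
  have cid : continuous (fun u : R => u) := @cont_id R.
  have c1 : continuous (fun u : R => 1 - 2 * u).
    by apply: contB; [exact: cont_cst|apply: contM => //; exact: cont_cst].
  have c2 : continuous (fun u : R => 4 * u * (1 - u)).
    apply: contM; first by apply: contM => //; exact: cont_cst.
    by apply: contB => //; exact: cont_cst.
  apply: rV_continuous => j; rewrite (_ : (fun _ => _) = (fun u =>
    if j == 0 then (1 - 2 * u) * a - 4 * u * (1 - u) * b else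
    if j == 1 then (1 - 2 * u) * b + 4 * u * (1 - u) * a else (1 - 2 * u) * c));
    last by apply/funext => u; rewrite mxE.
  case: (j == 0); first by apply: contB; apply: contM => //; exact: cont_cst.
  case: (j == 1); first by apply: contD; apply: contM => //; exact: cont_cst.
  by apply: contM => //; exact: cont_cst.
have loop_cont : continuous loop by exact: cont_proj_point.
have loopK u : loop u \in K.
  apply/mem_set.
  suff : range loop `<=` K by apply; exists u.
  apply: connected_component_max.
  - by exists 0.
  - move=> _ [t _ <-] /=; have [k k0 ->] := homog_proj_point (h0 t).
    rewrite -scalemxAl coneZ => /eqP; rewrite mulf_eq0 expf_eq0 /= (negPf k0) /=.
    by rewrite gt_eqF // hc.
  - apply: connected_continuous_connected; first exact/connected_intervalP.
    exact: continuous_subspaceT.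
(* The loop seen in the disc. *)
pose d u : 'rV[R]_2 := \val (f (exist _ (loop u) (loopK u))).
have d_disc u : disc (d u) by exact/set_mem/valP.
have d_cont : continuous d.
  apply: (cont_comp _ (@initial_continuous _ _ _)).
  apply: (cont_comp _ fc).
  by apply: continuous_comp_initial.
(* The contraction factor r satisfies r 0 = 0, r 1 = 1 and |r t| <= 1 for all real
   t, so that the homotopy is defined for all real parameters. *)
pose r (t : R) := 2 * t / (1 + t ^+ 2).
have t1 (t : R) : 0 < 1 + t ^+ 2 by have := sqr_ge0 t; lra.
have r1 t : r t ^+ 2 <= 1.
  rewrite /r expr_div_n ler_pdivrMr ?exprn_gt0 // mul1r -subr_ge0.
  by rewrite (_ : _ - _ = (1 - t ^+ 2) ^+ 2) ?sqr_ge0 //; ring.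
have rd t u : r t *: d u \in @disc R.
  apply/mem_set; rewrite /disc /= !mxE !exprMn -mulrDr.
  have := d_disc u; rewrite /disc /= => dd; apply: le_lt_trans dd.
  by rewrite ler_piMl ?addr_ge0 ?sqr_ge0 //; have := r1 t; rewrite /r !exprMn.
pose H t u : RP2 R := \val (g (exist _ (r t *: d u) (rd t u))).
have H_cont : continuous (fun p : R * R => H p.1 p.2).
  apply: (cont_comp _ (@initial_continuous _ _ _)).
  apply: (cont_comp _ gc).
  apply: continuous_comp_initial.
  apply: rV_continuous => j; rewrite (_ : (fun _ => _) = (fun p : R * R =>
    r p.1 * d p.2 0 j)); last by apply/funext => p; rewrite /= mxE.
  have c1 : continuous (fun p : R * R => p.1) := @cont_fst R R.
  have c2 : continuous (fun p : R * R => p.2) := @cont_snd R R.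
  apply: contM; last first.
    exact: (cont_comp c2 (@cont_coord _ _ _ _ j d_cont)).
  apply: contM; first by apply: contM => //; exact: cont_cst.
  apply: contV; first by move=> p; rewrite gt_eqF.
  by apply: contD; [exact: cont_cst|exact: contX].
have d01 : d 0 = d 1.
  rewrite /d; congr (\val (f _)); apply: val_inj => /=; by rewrite loop0 loop1.
have H01 t : H t 0 = H t 1.
  by rewrite /H; congr (\val (g _)); apply: val_inj => /=; rewrite d01.
have H0 u : H 0 u = H 0 0.
  by rewrite /H; congr (\val (g _)); apply: val_inj => /=; rewrite /r mulr0 mul0r !scale0r.
have H1 u : H 1 u = loop u.
  rewrite /H (_ : exist _ _ _ = f (exist _ (loop u) (loopK u))) ?fK //.
  apply: val_inj; rewrite /= /r expr1n mulr1 divff ?scale1r //.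
(* The constant loop lifts, hence so does the loop at t = 1. *)
have [|s [sc s01 sk]] := @lifts_all H H_cont H01.
  exists (fun _ => homog (H 0 0)); split=> //; first by move=> u; exact: cvg_cst.
  by move=> u _; exists 1; rewrite ?oner_eq0 // scale1r H0.
have s_neq0 u : u \in `[0, 1] -> dot (s u) (h u) != 0.
  move=> /sk [k k0 ->]; rewrite H1; have [l l0 ->] := homog_proj_point (h0 u).
  by rewrite !dotZl !mulf_neq0 // gt_eqF // dot_gt0.
have phi_cont : continuous (fun u => dot (s u) (h u)) by exact: cont_dot.
(* The lift s closes up and the path h ends at its opposite, although both remain
   on the same lines. *)
have phi1 : dot (s 1) (h 1) = - dot (s 0) (h 0).
  by rewrite s01 hx0 hx1 -scaleN1r dotZr mulN1r.
have [| |u u01 /eqP] := @IVT R (fun u => dot (s u) (h u)) 0 1 0 ler01.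
- exact: continuous_subspaceT.
- rewrite /= phi1 ge_min le_max oppr_le0 oppr_ge0.
  by have /orP[->|->] := le_total 0 (dot (s 0) (h 0)); rewrite ?orbT.
by apply/negP; exact: s_neq0.
Qed.
End OutsideCone.

(** * Brackets, and conics through five points *)

Section Bracket.
Variable K : comNzRingType.
Notation vect := (K * K * K)%type.
Implicit Types a b c d e f g : vect.

(** The determinant of three vectors. *)
Definition br a b c : K :=
  a.1.1 * (b.1.2 * c.2 - b.2 * c.1.2) - a.1.2 * (b.1.1 * c.2 - b.2 * c.1.1)
  + a.2 * (b.1.1 * c.1.2 - b.1.2 * c.1.1).

Lemma br_swap12 a b c : br b a c = - br a b c.
Proof. by rewrite /br; ring. Qed.

Lemma br_swap23 a b c : br a c b = - br a b c.
Proof. by rewrite /br; ring. Qed.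

(** The Grassmann-Pluecker relation in the quotient of the space by the vector p. *)
Lemma plucker p a b c d :
  br p a b * br p c d - br p a c * br p b d + br p a d * br p b c = 0.
Proof. by rewrite /br; ring. Qed.

(** Up to sign, the determinant of the 6 x 6 matrix of the monomials of degree 2 at
    the six points.  In this form it compares the values at e and f of two conics
    through a, b, c, d, the pairs of lines ab, cd and ac, bd. *)
Definition six a b c d e f : K :=
  br a b e * br c d e * (br a c f * br b d f) -
  br a c e * br b d e * (br a b f * br c d f).

Lemma six_swap12 a b c d e f : six b a c d e f = - six a b c d e f.
Proof. by rewrite /six /br; ring. Qed.

Lemma six_swap23 a b c d e f : six a c b d e f = - six a b c d e f.
Proof. by rewrite /six /br; ring. Qed.

Lemma six_swap34 a b c d e f : six a b d c e f = - six a b c d e f.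
Proof. by rewrite /six /br; ring. Qed.

Lemma six_swap45 a b c d e f : six a b c e d f = - six a b c d e f.
Proof. by rewrite /six /br; ring. Qed.

Lemma six_swap56 a b c d e f : six a b c d f e = - six a b c d e f.
Proof. by rewrite /six; ring. Qed.

(** The expansion of a 3 x 3 determinant with two equal rows: the three columns are the
    values at e, f, g of the two degenerate conics from the definition of [six]. *)
Lemma six_relation a b c d e f g :
  br a b e * br c d e * six a b c d f g - br a b f * br c d f * six a b c d e g
  + br a b g * br c d g * six a b c d e f = 0.
Proof. by rewrite /six; ring. Qed.

End Bracket.

Section ConicFive.
Variable R : realType.
Notation vect := (R * R * R)%type.

Definition coords3 (v : 'rV[R]_3) : vect := (v 0 0, v 0 1, v 0 2).

Definition cross (x y : vect) : 'rV[R]_3 := vec3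
  (x.1.2 * y.2 - x.2 * y.1.2) (x.2 * y.1.1 - x.1.1 * y.2)
  (x.1.1 * y.1.2 - x.1.2 * y.1.1).

Lemma dot_cross v x y : dot v (cross x y) = br (coords3 v) x y.
Proof. by rewrite /dot !vec3E /br /=; ring. Qed.

Definition qform (A : 'M[R]_3) (v : 'rV[R]_3) : R := (v *m A *m v^T) 0 0.
Definition bform (A : 'M[R]_3) (v w : 'rV[R]_3) : R := (v *m A *m w^T) 0 0.

Lemma bformE A v w : bform A v w =
  \sum_i \sum_j v 0 i * A i j * w 0 j.
Proof.
rewrite /bform mxE exchange_big; apply: eq_bigr => j _.
by rewrite !mxE mulr_suml.
Qed.

Section Sym.
Variable A : 'M[R]_3.
Hypothesis As : A^T = A.

Lemma symE i j : A j i = A i j.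
Proof. by rewrite -{1}As mxE. Qed.

Lemma bform3E v w : bform A v w =
  v 0 0 * w 0 0 * A 0 0 + v 0 1 * w 0 1 * A 1 1 + v 0 2 * w 0 2 * A 2 2 +
  (v 0 0 * w 0 1 + v 0 1 * w 0 0) * A 0 1 +
  (v 0 0 * w 0 2 + v 0 2 * w 0 0) * A 0 2 +
  (v 0 1 * w 0 2 + v 0 2 * w 0 1) * A 1 2.
Proof.
rewrite bformE !sum_I3 (symE 0 1) (symE 0 2) (symE 1 2); ring.
Qed.

(** Cramer's rule for the coordinates of v in the basis a, b, c. *)
Lemma qform_basis (a b c v : 'rV[R]_3) :
  let l1 := br (coords3 v) (coords3 b) (coords3 c) in
  let l2 := br (coords3 a) (coords3 v) (coords3 c) in
  let l3 := br (coords3 a) (coords3 b) (coords3 v) in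
  br (coords3 a) (coords3 b) (coords3 c) ^+ 2 * qform A v =
  l1 ^+ 2 * qform A a + l2 ^+ 2 * qform A b + l3 ^+ 2 * qform A c +
  2 * (bform A b c * (l2 * l3) + bform A a c * (l1 * l3) + bform A a b * (l1 * l2)).
Proof.
rewrite /= -[qform]/(fun A v => bform A v v) /= !bform3E /br /coords3 /=; ring.
Qed.

Lemma qform_eq0 : (forall v, qform A v = 0) -> A = 0.
Proof.
move=> q0.
have b0 v w : bform A v w = 0.
  have := q0 (v + w); rewrite /qform -/(bform A (v + w) (v + w)) bform3E !mxE.
  have := q0 v; have := q0 w; rewrite /qform -!/(bform A _ _) !bform3E; lra.
apply/matrixP => i j; rewrite mxE -(b0 (delta_mx 0 i) (delta_mx 0 j)) bformE.
rewrite (bigD1 i) //= (bigD1 j) //= !mxE !eqxx mul1r mulr1.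
rewrite big1 ?big1 ?addr0 // => [k ki|k kj].
  by rewrite big1 // => l _; rewrite !mxE (negPf ki) mul0r mul0r.
by rewrite !mxE (negPf kj) /= mulr0.
Qed.

End Sym.

Section Five.
Variables a b c d e : 'rV[R]_3.
Notation "[| x , y , z |]" := (br (coords3 x) (coords3 y) (coords3 z)).
Hypotheses (abc : 0 < [|a, b, c|]) (abd : 0 < [|a, b, d|]) (abe : 0 < [|a, b, e|])
  (acd : 0 < [|a, c, d|]) (ace : 0 < [|a, c, e|]) (ade : 0 < [|a, d, e|])
  (bcd : 0 < [|b, c, d|]) (bce : 0 < [|b, c, e|]) (bde : 0 < [|b, d, e|])
  (cde : 0 < [|c, d, e|]).

Let D := [|a, b, c|].
Let m1 := [|b, c, d|] * [|b, c, e|] * [|a, d, e|].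
Let m2 := [|a, c, d|] * [|a, c, e|] * [|b, d, e|].
Let m3 := [|a, b, d|] * [|a, b, e|] * [|c, d, e|].
Let l1 v := [|v, b, c|].
Let l2 v := [|a, v, c|].
Let l3 v := [|a, b, v|].

Definition five v :=
  six (coords3 a) (coords3 b) (coords3 c) (coords3 d) (coords3 e) (coords3 v).

(** In the coordinates of the basis a, b, c, a conic through a, b, c has only mixed
    terms; m1, m2, m3 are the coefficients of the one that also passes through d
    and e. *)
Lemma fiveE v :
  m1 * (l2 v * l3 v) + m2 * (l1 v * l3 v) + m3 * (l1 v * l2 v) = - D * five v.
Proof. rewrite /m1 /m2 /m3 /l1 /l2 /l3 /D /five /six /br /=; ring. Qed.

Let cr (x y : 'rV[R]_3) : 'rV[R]_3 := cross (coords3 x) (coords3 y).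

Let dot_cr v x y : dot v (cr x y) = [|v, x, y|].
Proof. exact: dot_cross. Qed.

Section Through.
Variable A : 'M[R]_3.
Hypotheses (As : A^T = A) (A0 : A != 0).
Hypotheses (Aa : qform A a = 0) (Ab : qform A b = 0) (Ac : qform A c = 0)
  (Ad : qform A d = 0) (Ae : qform A e = 0).

Let m1_gt0 : 0 < m1. Proof. by rewrite !mulr_gt0. Qed.
Let m2_gt0 : 0 < m2. Proof. by rewrite !mulr_gt0. Qed.
Let m3_gt0 : 0 < m3. Proof. by rewrite !mulr_gt0. Qed.

Let P v := bform A b c * (l2 v * l3 v) + bform A a c * (l1 v * l3 v) +
  bform A a b * (l1 v * l2 v).

Let qformP v : D ^+ 2 * qform A v = 2 * P v.
Proof. by rewrite (qform_basis As a b c v) Aa Ab Ac !mulr0 !add0r. Qed.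

Let k := bform A b c / m1.

Let coefE : [/\ bform A b c = k * m1, bform A a c = k * m2 & bform A a b = k * m3].
Proof.
have e1 : bform A b c = k * m1 by rewrite /k divfK // gt_eqF.
have PX x : qform A x = 0 -> P x = 0.
  move=> q; have := qformP x; rewrite q mulr0 => /esym/eqP.
  by rewrite mulf_eq0 pnatr_eq0 /= => /eqP.
have Pd := PX _ Ad; have Pe := PX _ Ae.
have D0 : D != 0 by rewrite gt_eqF.
have M1 : l1 d * l1 e * (l3 d * l2 e - l2 d * l3 e) = - D * m1.
  by rewrite /m1 /l1 /l2 /l3 /D /br /=; ring.
have M2 : l2 d * l2 e * (l1 d * l3 e - l3 d * l1 e) = - D * m2.
  by rewrite /m2 /l1 /l2 /l3 /D /br /=; ring.
have M3 : l3 d * l3 e * (l2 d * l1 e - l1 d * l2 e) = - D * m3.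
  by rewrite /m3 /l1 /l2 /l3 /D /br /=; ring.
(* The coefficients are orthogonal to the two vectors (l2 l3, l1 l3, l1 l2) at d
   and e, hence proportional to their cross product - D (m1, m2, m3). *)
have e12 : D * (bform A b c * m2 - bform A a c * m1) = 0.
  transitivity (bform A a c * (- - D * m1) * -1 - bform A b c * (- D * m2));
    first by ring.
  transitivity (P d * (l1 e * l2 e) - P e * (l1 d * l2 d)); last by rewrite Pd Pe; ring.
  rewrite mulNr -M1 -M2 /P; ring.
have e13 : D * (bform A b c * m3 - bform A a b * m1) = 0.
  transitivity (bform A a b * (- - D * m1) * -1 - bform A b c * (- D * m3));
    first by ring.
  transitivity (P e * (l1 d * l3 d) - P d * (l1 e * l3 e)); last by rewrite Pd Pe; ring.
  rewrite mulNr -M1 -M3 /P; ring.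
move/eqP: e12; rewrite mulf_eq0 (negPf D0) subr_eq0 => /eqP e12.
move/eqP: e13; rewrite mulf_eq0 (negPf D0) subr_eq0 => /eqP e13.
have m10 : m1 != 0 by rewrite gt_eqF.
by split=> //; apply: (mulIf m10); rewrite -?e12 -?e13 e1; ring.
Qed.

Let PE v : P v = - (k * D) * five v.
Proof.
have [e1 e2 e3] := coefE.
by rewrite mulNr -mulrA -mulrN -mulNr -fiveE /P e1 e2 e3; ring.
Qed.

Let k_neq0 : k != 0.
Proof.
apply: contraNneq A0 => k0; apply/eqP/(qform_eq0 As) => v.
have /eqP := qformP v; rewrite PE k0 mul0r oppr0 mul0r mulr0 mulf_eq0.
by rewrite expf_eq0 /= gt_eqF // => /eqP.
Qed.

(** The conic is unique: its form is proportional to [five]. *)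
Lemma qform_through_five : exists2 k, k != 0 & forall v, qform A v = k * five v.
Proof.
exists (- 2 * k / D).
  apply: mulf_neq0; last by rewrite invr_eq0 gt_eqF.
  by apply: mulf_neq0 => //; rewrite oppr_eq0 pnatr_eq0.
move=> v; have D0 : D != 0 by rewrite gt_eqF.
apply: (mulfI (expf_neq0 2 D0)); rewrite qformP PE.
by field.
Qed.

(** In the coordinates of a, b, c the form is al yz + be xz + ga xy, which rescales to
    al be ga (yz + xz + xy) and is then -al be ga times [cone] in other coordinates.
    Positivity of the brackets gives al, be, ga the same sign, and this sign
    cancels against that of the form relative to [five]. *)
Lemma inside_through_five x : inside (conic_of A) x <-> five (homog x) < 0.
Proof.
have D0 : D != 0 by rewrite gt_eqF.
have [e1 e2 e3] := coefE.
pose al := k * m1; pose be := k * m2; pose ga := k * m3.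
have al0 : al != 0 by rewrite mulf_neq0 // gt_eqF.
have be0 : be != 0 by rewrite mulf_neq0 // gt_eqF.
have ga0 : ga != 0 by rewrite mulf_neq0 // gt_eqF.
(* The form becomes al be ga (y1 y2 + y3 (y1 + y2)), and with s, t the half sum and
   half difference of y1, y2 this is (s + y3)^2 - t^2 - y3^2 times al be ga. *)
pose y1 v := l1 v / al; pose y2 v := l2 v / be; pose y3 v := l3 v / ga.
pose G : 'M[R]_3 := \matrix_(i, j)
  (if j == 0 then (cr b c 0 i / al - cr c a 0 i / be) / 2
   else if j == 1 then cr a b 0 i / ga
   else (cr b c 0 i / al + cr c a 0 i / be) / 2 + cr a b 0 i / ga).
have GE v : v *m G = vec3 ((y1 v - y2 v) / 2) (y3 v) ((y1 v + y2 v) / 2 + y3 v).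
  apply: row3_eq; rewrite !mxE sum_I3 !mxE /= /y1 /y2 /y3 /l1 /l2 /l3 /br /=; ring.
have qE v : D ^+ 2 * qform A v = - (2 * (al * be * ga)) * cone (v *m G).
  rewrite qformP /P e1 e2 e3 -/al -/be -/ga GE /cone !vec3E /y1 /y2 /y3; field.
  by rewrite ga0 be0 al0.
have Gu : G \in unitmx.
  rewrite -row_free_unit; apply/inj_row_free => v; rewrite GE => z.
  have /rowP z' := z.
  have := z' 0; have := z' 1; have := z' 2; rewrite !vec3E !mxE => z2 z1 z0.
  have y10 : y1 v = 0 by lra.
  have y20 : y2 v = 0 by lra.
  have L1 : l1 v = 0 by have := divfK al0 (l1 v); rewrite -/(y1 v) y10 mul0r.
  have L2 : l2 v = 0 by have := divfK be0 (l2 v); rewrite -/(y2 v) y20 mul0r.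
  have L3 : l3 v = 0 by have := divfK ga0 (l3 v); rewrite -/(y3 v) z1 mul0r.
  have Dv j : D * v 0 j = 0.
    transitivity (l1 v * a 0 j + l2 v * b 0 j + l3 v * c 0 j); last first.
      by rewrite L1 L2 L3 !mul0r !addr0.
    have : D *: v = l1 v *: a + l2 v *: b + l3 v *: c.
      by apply: row3_eq; rewrite !mxE /D /l1 /l2 /l3 /br /=; ring.
    by move/rowP/(_ j); rewrite !mxE.
  apply/rowP => j; have /eqP := Dv j.
  by rewrite mulf_eq0 (negPf D0) mxE => /eqP.
have c0 : - (2 * (al * be * ga)) != 0.
  rewrite oppr_eq0; apply: mulf_neq0; first by rewrite pnatr_eq0.
  by apply: mulf_neq0 => //; apply: mulf_neq0.
have conicE : conic_of A = [set y | cone (homog y *m G) = 0].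
  apply/seteqP; split=> y /= q0; last suff : qform A (homog y) = 0 by [].
    have {}q0 : qform A (homog y) = 0 := q0.
    by apply: (mulfI c0); rewrite -qE q0 !mulr0.
  by apply: (mulfI (expf_neq0 2 D0)); rewrite qE q0 !mulr0.
have sgn : (cone (homog x *m G) < 0) = (five (homog x) < 0).
  have kcone : k ^+ 2 * m1 * m2 * m3 * cone (homog x *m G) = D * five (homog x).
    have two0 : 2 != 0 :> R by rewrite pnatr_eq0.
    apply: (mulfI k_neq0); apply: (mulfI two0).
    transitivity (- (2 * P (homog x))); last by rewrite PE; ring.
    by rewrite -qformP qE /al /be /ga; ring.
  have kp : 0 < k ^+ 2 * m1 * m2 * m3.
    by rewrite (pmulr_lgt0 _ m3_gt0) (pmulr_lgt0 _ m2_gt0) (pmulr_lgt0 _ m1_gt0)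
      exprn_even_gt0.
  by rewrite -(pmulr_rlt0 _ kp) kcone pmulr_rlt0.
rewrite conicE; split=> [ins_x|h]; last by apply: inside_cone_neg; rewrite //= sgn.
rewrite -sgn ltNge le_eqVlt negb_or; apply/andP; split.
  by rewrite eq_sym; apply/eqP; case: ins_x.
by apply/negP => h; apply: (not_inside_cone_pos Gu h).
Qed.

End Through.

Let lin (w z : 'rV[R]_3) : 'M[R]_3 := w^T *m z + z^T *m w.

Let linT w z : (lin w z)^T = lin w z.
Proof. by rewrite /lin linearD /= !trmx_mul !trmxK addrC. Qed.

Let linE w z v : qform (lin w z) v = 2 * (dot v w * dot v z).
Proof.
by rewrite /qform -/(bform _ v v) bform3E ?linT // !mxE !big_ord1 !mxE /dot; ring.
Qed.

Lemma exists_conic_through_five : exists A : 'M[R]_3,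
  [/\ A^T = A, A != 0 & forall v, qform A v = five v].
Proof.
pose A := ([|a, b, e|] * [|c, d, e|] / 2) *: lin (cr a c) (cr b d) -
  ([|a, c, e|] * [|b, d, e|] / 2) *: lin (cr a b) (cr c d).
have AE v : qform A v = five v.
  have qD B C : qform (B + C) v = qform B v + qform C v.
    by rewrite /qform mulmxDr mulmxDl mxE.
  have qZ k B : qform (k *: B) v = k * qform B v.
    by rewrite /qform -scalemxAr -scalemxAl mxE.
  rewrite /A -scaleNr qD !qZ !linE !dot_cr /five /six /br /=.
  by field.
exists A; split=> //.
  by rewrite /A linearB /= !linearZ /= !linT.
(* The conic does not meet the open chord ab. *)
apply/eqP => A0; have := AE (a + b).
rewrite A0 /qform mulmx0 mul0mx mxE => /esym/eqP; apply/negP.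
rewrite (_ : five _ = - ([|a, b, c|] * [|a, b, d|] * [|a, b, e|] * [|c, d, e|])).
  by rewrite oppr_eq0 gt_eqF // !mulr_gt0.
by rewrite /five /six /br /= !mxE; ring.
Qed.

End Five.
End ConicFive.

(** * Sign patterns as a finite search *)

Local Open Scope nat_scope.

Fixpoint insert_sign (x : nat) (s : seq nat) : bool * seq nat :=
  if s is y :: s' then
    if y < x then let: (p, t) := insert_sign x s' in (~~ p, y :: t) else (false, x :: s)
  else (false, [:: x]).

(** Sorts, and computes the parity of the sorting permutation, so that alternating
    functions of labels are determined by their values on increasing tuples. *)
Fixpoint sort_sign (s : seq nat) : bool * seq nat :=
  if s is x :: s' then
    let: (p, t) := sort_sign s' in let: (q, r) := insert_sign x t in (p (+) q, r)
  else (false, [::]).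

Section Alternating.
Local Open Scope ring_scope.
Variables (K : comNzRingType) (F : seq nat -> K).
Hypothesis F_swap : forall s x y t, F (s ++ x :: y :: t) = - F (s ++ y :: x :: t).

Lemma alternating_insert x s r :
  F (r ++ x :: s) = (-1) ^+ (insert_sign x s).1 * F (r ++ (insert_sign x s).2).
Proof.
elim: s r => [|y s IH] r /=; first by rewrite mul1r.
case: ifP => _ /=; last by rewrite mul1r.
have := IH (rcons r y); case: (insert_sign x s) => p t /=; rewrite !cat_rcons => e.
by rewrite F_swap e signrN mulNr.
Qed.

Lemma alternating_sort s : F s = (-1) ^+ (sort_sign s).1 * F (sort_sign s).2.
Proof.
suff: forall r, F (r ++ s) = (-1) ^+ (sort_sign s).1 * F (r ++ (sort_sign s).2).
  by move/(_ [::]).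
elim: s => [|x s IH] r /=; first by rewrite mul1r.
have := IH (rcons r x); case: (sort_sign s) => p t /=; rewrite !cat_rcons => ->.
rewrite alternating_insert; case: (insert_sign x t) => q v /=.
by rewrite signr_addb mulrA.
Qed.
End Alternating.

Fixpoint subseqs (T : Type) (k : nat) (s : seq T) : seq (seq T) :=
  match k, s with
  | 0, _ => [:: [::]]
  | _, [::] => [::]
  | k'.+1, x :: s' => [seq x :: t | t <- subseqs k' s'] ++ subseqs k s'
  end.

Lemma mem_subseqs (T : eqType) (s t : seq T) : subseq t s -> t \in subseqs (size t) s.
Proof.
elim: s t => [|x s IH] [|y t] //=; rewrite ?inE // mem_cat.
case: eqP => [-> /IH h|_ /IH h]; last by rewrite h orbT.
by rewrite map_f.
Qed.

Definition labels := iota 0 8.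
Definition sextuples : seq (seq nat) := Eval vm_compute in subseqs 6 labels.
Definition triangles : seq (seq nat) := Eval vm_compute in subseqs 3 labels.

(** A literal (i, p) stands for the i-th of the 28 signs, changed if p holds;
    [literal_of s] is the one that gives the sign of [six] at labels s in any order. *)
Definition literal := (nat * bool)%type.
Definition literal_of (s : seq nat) : literal :=
  let: (p, t) := sort_sign s in (index t sextuples, p).
Definition value (b : seq bool) (l : literal) : bool := l.2 (+) nth false b l.1.
Definition shift_sign (p : bool) (l : literal) : literal := (l.1, p (+) l.2).

Definition clause := seq literal.
Definition mixed (b : seq bool) (c : clause) :=
  has (value b) c && has (fun l => ~~ value b l) c.

Definition odd3 a b c := (sort_sign [:: a; b; c]).1.
(** The three terms of [six_relation], as literals giving the sign of each term when
    all increasing brackets are positive.  The middle term enters with a minus sign. *)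
Definition relation_clause (s : seq nat) : clause :=
  if s is [:: a; b; c; d; e; f; g] then
    [:: shift_sign (odd3 a b e (+) odd3 c d e) (literal_of [:: a; b; c; d; f; g]);
        shift_sign (~~ (odd3 a b f (+) odd3 c d f)) (literal_of [:: a; b; c; d; e; g]);
        shift_sign (odd3 a b g (+) odd3 c d g) (literal_of [:: a; b; c; d; e; f])]
  else [::].

(** For each seven labels and each four of them, one order for each of the three ways
    to split these four into two pairs. *)
Definition septuples : seq (seq nat) :=
  [seq t ++ [seq x <- s | x \notin t] | s <- subseqs 7 labels, t <-
    flatten [seq if q is [:: a; b; c; d] then [:: q; [:: a; c; b; d]; [:: a; d; b; c]]
     else [::] | q <- subseqs 4 s]].

Definition clauses : seq clause := Eval vm_compute in map relation_clause septuples.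

Lemma clausesE : clauses = map relation_clause septuples.
Proof. by vm_cast_no_check (erefl clauses). Qed.

(** The clauses that become decidable with the choice of the n-th sign. *)
Definition level (n : nat) :=
  [seq c <- clauses |
    all (fun l : literal => l.1 <= n) c && has (fun l : literal => l.1 == n) c].

Fixpoint search (n : nat) : seq (seq bool) :=
  if n is m.+1 then
    let cs := level m in
    [seq b <- flatten [seq [:: rcons b true; rcons b false] | b <- search m] |
       all (mixed b) cs]
  else [:: [::]].

(** The heart of the upper bound.  The search tree has a few thousand nodes. *)
Lemma size_search : size (search 28) = 752.
Proof. by vm_cast_no_check (erefl 752). Qed.

Definition br_at (K : comNzRingType) (u : nat -> K * K * K) (s : seq nat) : K :=
  if s is [:: a; b; c] then br (u a) (u b) (u c) else 0%R.
Definition six_at (K : comNzRingType) (u : nat -> K * K * K) (s : seq nat) : K :=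
  if s is [:: a; b; c; d; e; f] then six (u a) (u b) (u c) (u d) (u e) (u f) else 0%R.

Section Signs.
Local Open Scope ring_scope.
Variable R : realDomainType.
Implicit Types u : nat -> R * R * R.
Definition positive u := all (fun s => 0 < br_at u s) triangles.
Definition nondegenerate u := all (fun s => six_at u s != 0) sextuples.
(** true where [six] is negative, that is where the last point is inside the conic
    through the five others. *)
Definition signs u := [seq six_at u s < 0 | s <- sextuples].
End Signs.

Definition octagon_coord (c : seq (nat * nat)) (i : nat) : Z * Z * Z :=
  let p := nth (0, 0) c i in (Z.of_nat p.1, Z.of_nat p.2, 1%R).

(** Affine coordinates of the vertices in counterclockwise order, one octagon for each
    orbit of lists, found among random convex octagons. *)
Definition octagons : seq (seq (nat * nat)) := [::
  [:: (2, 8); (0, 6); (0, 3); (2, 0); (6, 2); (7, 4); (7, 5); (6, 8)];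
  [:: (10, 9); (10, 10); (9, 10); (2, 9); (0, 5); (1, 1); (4, 0); (9, 0)];
  [:: (10, 10); (1, 10); (0, 9); (0, 8); (1, 2); (3, 0); (6, 0); (10, 3)];
  [:: (10, 6); (10, 7); (0, 10); (0, 2); (1, 1); (4, 0); (5, 0); (8, 1)];
  [:: (6, 9); (4, 7); (0, 0); (4, 0); (7, 1); (9, 4); (9, 6); (8, 9)];
  [:: (0, 5); (1, 1); (2, 0); (7, 0); (8, 2); (8, 8); (4, 9); (0, 9)];
  [:: (10, 10); (1, 10); (0, 9); (0, 3); (1, 1); (3, 0); (7, 1); (9, 2)];
  [:: (0, 6); (0, 4); (4, 0); (7, 1); (8, 2); (8, 3); (5, 6); (2, 7)];
  [:: (11, 5); (10, 7); (2, 9); (0, 8); (1, 0); (2, 0); (10, 1); (11, 2)];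
  [:: (10, 10); (2, 10); (1, 9); (0, 5); (0, 2); (2, 0); (5, 0); (10, 1)];
  [:: (5, 7); (2, 3); (0, 0); (2, 0); (9, 1); (9, 5); (8, 7); (6, 8)];
  [:: (7, 10); (4, 10); (0, 9); (0, 2); (2, 0); (7, 1); (9, 2); (9, 3)];
  [:: (2, 7); (0, 5); (0, 2); (2, 0); (4, 0); (10, 3); (9, 9); (6, 9)];
  [:: (0, 4); (1, 0); (7, 0); (8, 3); (7, 6); (6, 8); (5, 9); (1, 9)];
  [:: (10, 6); (10, 8); (8, 10); (5, 10); (0, 1); (2, 0); (3, 0); (9, 2)];
  [:: (10, 5); (10, 9); (2, 10); (1, 10); (0, 9); (0, 7); (3, 0); (9, 1)];
  [:: (1, 7); (0, 4); (1, 0); (3, 0); (7, 1); (8, 2); (7, 4); (3, 8)];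
  [:: (0, 5); (0, 3); (1, 0); (3, 0); (8, 1); (7, 4); (5, 7); (3, 8)];
  [:: (8, 9); (6, 10); (2, 10); (0, 0); (5, 0); (8, 2); (9, 3); (9, 4)];
  [:: (2, 6); (1, 4); (0, 1); (3, 0); (7, 0); (8, 2); (8, 5); (4, 9)];
  [:: (0, 8); (0, 1); (1, 0); (5, 1); (6, 2); (9, 6); (10, 8); (2, 9)];
  [:: (8, 9); (4, 10); (3, 10); (1, 9); (0, 0); (9, 1); (10, 2); (10, 4)];
  [:: (9, 8); (8, 10); (0, 0); (1, 0); (5, 1); (7, 2); (8, 3); (9, 6)];
  [:: (0, 4); (2, 2); (6, 0); (7, 0); (8, 1); (8, 3); (7, 6); (3, 6)];
  [:: (11, 7); (1, 11); (0, 9); (1, 2); (2, 1); (8, 0); (9, 1); (10, 3)];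
  [:: (11, 8); (8, 10); (5, 10); (2, 8); (0, 3); (0, 2); (1, 1); (11, 0)];
  [:: (0, 7); (1, 4); (2, 2); (6, 0); (9, 1); (8, 4); (5, 6); (2, 7)];
  [:: (0, 6); (0, 2); (2, 1); (5, 0); (7, 0); (9, 3); (8, 8); (6, 9)];
  [:: (10, 6); (9, 9); (7, 10); (5, 10); (0, 8); (0, 7); (1, 0); (8, 0)];
  [:: (2, 6); (0, 1); (0, 0); (1, 0); (7, 1); (8, 5); (8, 6); (5, 7)];
  [:: (1, 5); (0, 1); (1, 0); (8, 0); (9, 1); (9, 5); (7, 7); (3, 7)];
  [:: (9, 5); (6, 7); (0, 7); (0, 5); (3, 1); (7, 0); (8, 0); (10, 1)];
  [:: (0, 8); (2, 4); (6, 0); (7, 0); (9, 1); (10, 5); (6, 7); (0, 9)];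
  [:: (10, 9); (6, 10); (2, 8); (1, 7); (0, 3); (0, 1); (1, 0); (10, 0)];
  [:: (0, 6); (0, 4); (1, 2); (8, 0); (9, 0); (9, 6); (7, 8); (5, 8)];
  [:: (0, 7); (0, 4); (1, 1); (3, 0); (4, 1); (7, 5); (5, 8); (2, 8)];
  [:: (2, 6); (0, 4); (1, 1); (3, 0); (5, 0); (8, 5); (8, 6); (7, 7)];
  [:: (10, 5); (9, 7); (7, 9); (5, 10); (3, 10); (0, 8); (0, 0); (10, 4)];
  [:: (1, 9); (0, 4); (1, 3); (4, 1); (7, 0); (7, 2); (5, 9); (3, 10)];
  [:: (1, 8); (0, 6); (1, 0); (3, 0); (5, 1); (9, 4); (7, 7); (4, 8)];
  [:: (9, 10); (4, 10); (1, 9); (0, 7); (0, 6); (1, 1); (3, 0); (10, 1)];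
  [:: (0, 7); (2, 1); (5, 0); (6, 0); (8, 3); (8, 5); (7, 7); (1, 9)];
  [:: (5, 7); (0, 3); (1, 0); (3, 0); (6, 2); (8, 5); (9, 7); (7, 8)];
  [:: (9, 10); (6, 11); (4, 11); (0, 8); (0, 1); (2, 0); (3, 0); (11, 5)];
  [:: (11, 6); (11, 7); (2, 10); (1, 10); (0, 3); (0, 2); (5, 0); (9, 1)];
  [:: (3, 9); (0, 3); (3, 1); (5, 0); (8, 1); (7, 6); (6, 9); (4, 10)];
  [:: (10, 10); (2, 10); (0, 8); (0, 7); (2, 2); (3, 1); (7, 0); (9, 1)]].

Lemma octagons_good :
  all (fun c => positive (octagon_coord c) && nondegenerate (octagon_coord c)) octagons.
Proof. by vm_cast_no_check (erefl true). Qed.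

(** (f, k) stands for the reflection i |-> 7 - i if f holds, followed by the rotation
    by k. *)
Definition dihedral_index : seq (bool * nat) :=
  [seq (f, k) | f <- [:: false; true], k <- labels].
Definition dihedral_map (g : bool * nat) (i : nat) : nat :=
  ((if g.1 then 7 - i else i) + g.2) %% 8.

Definition dihedral_literals (g : bool * nat) : seq literal :=
  [seq literal_of (map (dihedral_map g) t) | t <- sextuples].
Definition dihedral_signs (g : bool * nat) (b : seq bool) : seq bool :=
  map (value b) (dihedral_literals g).

(** Splitting on the successive bits needs far fewer comparisons than testing all pairs. *)
Fixpoint distinct (n : nat) (bs : seq (seq bool)) : bool :=
  match n, bs with
  | _, [::] | _, [:: _] => true
  | 0, _ => false
  | m.+1, _ => distinct m [seq behead b | b <- bs & head false b] &&
               distinct m [seq behead b | b <- bs & ~~ head false b]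
  end.

Definition all_signs : seq (seq bool) :=
  let ls := map dihedral_literals dihedral_index in
  flatten [seq let b := signs (octagon_coord c) in [seq map (value b) l | l <- ls]
    | c <- octagons].

Lemma all_signs_distinct : distinct 28 all_signs.
Proof. by vm_cast_no_check (erefl true). Qed.

Local Open Scope ring_scope.

(** * Signs of configurations *)

Section Signs.
Variable R : realDomainType.
Implicit Types u : nat -> R * R * R.

Lemma lt0_mul (x y : R) : x != 0 -> y != 0 -> (x * y < 0) = (x < 0) (+) (y < 0).
Proof.
move=> x0 y0; case: (ltP x 0) => hx /=; first by rewrite nmulr_rlt0 // lt0r y0 leNgt.
by rewrite pmulr_rlt0 // lt0r x0.
Qed.

Lemma lt0_sign (p : bool) (x : R) : x != 0 -> ((-1) ^+ p * x < 0) = p (+) (x < 0).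
Proof. by move=> x0; rewrite lt0_mul ?signr_eq0 // signr_lt0. Qed.

Lemma lt0_sum (x y z : R) : x - y + z = 0 -> x != 0 -> y != 0 ->
  has id [:: x < 0; ~~ (y < 0); z < 0] && has negb [:: x < 0; ~~ (y < 0); z < 0].
Proof.
move=> e x0 y0; rewrite /= orbF orbF.
by case: (ltgtP x 0) x0 => // hx _; case: (ltgtP y 0) y0 => // hy _;
  case: (ltP z 0) => hz //; exfalso; lra.
Qed.

Lemma br_at_swap u s x y t : br_at u (s ++ x :: y :: t) = - br_at u (s ++ y :: x :: t).
Proof.
case: s => [|a [|b [|c s]]] /=; rewrite ?oppr0 //.
- case: t => [|z [|w t]] /=; rewrite ?oppr0 //; exact: br_swap12.
- case: t => [|z t] /=; rewrite ?oppr0 //; exact: br_swap23.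
- by case: s => [|? ?] /=; rewrite oppr0.
Qed.

Lemma six_at_swap u s x y t : six_at u (s ++ x :: y :: t) = - six_at u (s ++ y :: x :: t).
Proof.
case: s => [|a [|b [|c [|d [|e s]]]]] /=.
- case: t => [|? [|? [|? [|? [|? ?]]]]] /=; rewrite ?oppr0 //; exact: six_swap12.
- case: t => [|? [|? [|? [|? ?]]]] /=; rewrite ?oppr0 //; exact: six_swap23.
- case: t => [|? [|? [|? ?]]] /=; rewrite ?oppr0 //; exact: six_swap34.
- case: t => [|? [|? ?]] /=; rewrite ?oppr0 //; exact: six_swap45.
- case: t => [|? ?] /=; rewrite ?oppr0 //; exact: six_swap56.
- by case: s => [|? [|? ?]] /=; rewrite oppr0.
Qed.

Lemma odd3E u a b c : positive u -> (sort_sign [:: a; b; c]).2 \in triangles ->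
  br (u a) (u b) (u c) != 0 /\ (br (u a) (u b) (u c) < 0) = odd3 a b c.
Proof.
move=> /allP up /up h; have := alternating_sort (@br_at_swap u) [:: a; b; c].
rewrite [br_at u [:: a; b; c]]/= => ->; have h0 := lt0r_neq0 h.
by rewrite mulf_neq0 ?signr_eq0 // lt0_sign // ltNge (ltW h) addbF.
Qed.

Lemma nth_signs u i : (i < 28)%N ->
  nth false (signs u) i = (six_at u (nth [::] sextuples i) < 0).
Proof. by move=> i28; rewrite (nth_map [::]). Qed.

(** The bound 28 says that the sorted labels are an increasing 6-tuple of labels. *)
Lemma value_literal_of u s : nondegenerate u -> ((literal_of s).1 < 28)%N ->
  six_at u s != 0 /\ value (signs u) (literal_of s) = (six_at u s < 0).
Proof.
move=> un; rewrite /literal_of; have := alternating_sort (@six_at_swap u) s.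
case: (sort_sign s) => p t /= -> lt28.
have tin : t \in sextuples by rewrite -index_mem.
have t0 := allP un _ tin.
rewrite mulf_neq0 ?signr_eq0 // lt0_sign // /value /= nth_signs //.
by rewrite nth_index.
Qed.

Definition well_formed (s : seq nat) : bool :=
  if s is [:: a; b; c; d; e; f; g] then
    [&& (sort_sign [:: a; b; e]).2 \in triangles, (sort_sign [:: c; d; e]).2 \in triangles,
        (sort_sign [:: a; b; f]).2 \in triangles, (sort_sign [:: c; d; f]).2 \in triangles,
        (sort_sign [:: a; b; g]).2 \in triangles, (sort_sign [:: c; d; g]).2 \in triangles &
        all (fun l : literal => (l.1 < 28)%N) (relation_clause s)]
  else false.

Lemma septuples_well_formed : all well_formed septuples.
Proof. by vm_cast_no_check (erefl true). Qed.

Lemma value_shift_sign b p l : value b (shift_sign p l) = p (+) value b l.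
Proof. by rewrite /value /= addbA. Qed.

(** [six_relation] excludes that its three terms have the same sign. *)
Lemma mixed_relation u s : positive u -> nondegenerate u -> well_formed s ->
  mixed (signs u) (relation_clause s).
Proof.
move=> up un; case: s => [|a [|b [|c [|d [|e [|f [|g [|//]]]]]]]] //.
move=> /and5P[abe cde abf cdf /and3P[abg cdg]].
rewrite /relation_clause.
set l1 := literal_of _; set l2 := literal_of [:: a; b; c; d; e; g]; set l3 := literal_of _.
move=> /and4P[i1 i2 i3 _].
have [n1 e1] := odd3E up abe; have [n2 e2] := odd3E up cde.
have [n3 e3] := odd3E up abf; have [n4 e4] := odd3E up cdf.
have [n5 e5] := odd3E up abg; have [n6 e6] := odd3E up cdg.
have [m1 f1] := value_literal_of un i1; have [m2 f2] := value_literal_of un i2.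
have [m3 f3] := value_literal_of un i3.
have := six_relation (u a) (u b) (u c) (u d) (u e) (u f) (u g).
rewrite /mixed /= !value_shift_sign f1 f2 f3 -e1 -e2 -e3 -e4 -e5 -e6 /=.
rewrite -!lt0_mul ?mulf_neq0 // addNb -lt0_mul ?mulf_neq0 //.
by move/lt0_sum; rewrite /= !mulf_neq0 //; apply.
Qed.

Lemma size_signs u : size (signs u) = 28%N.
Proof. by rewrite size_map. Qed.

End Signs.

Lemma mixed_take n b c : all (fun l : literal => (l.1 <= n)%N) c ->
  mixed (take n.+1 b) c = mixed b c.
Proof.
move=> h; rewrite /mixed; congr (_ && _); apply: eq_in_has => l /(allP h) ln;
  by rewrite /value nth_take.
Qed.

(** The test of the first n signs involves only clauses on these signs. *)
Lemma search_complete b n : (n <= size b)%N -> all (mixed b) clauses ->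
  take n b \in search n.
Proof.
move=> nb ok; elim: n nb => [|n IH] nb; first by rewrite take0.
rewrite [search _]/= mem_filter; apply/andP; split.
  apply/allP => c; rewrite mem_filter => /andP[/andP[cn _] cin].
  by rewrite mixed_take // (allP ok).
apply/flattenP; exists [:: rcons (take n b) true; rcons (take n b) false].
  by apply/map_f/IH/ltnW.
rewrite (take_nth false) // !inE.
by case: (nth _ _ _); rewrite eqxx ?orbT.
Qed.

Lemma signs_search (R : realDomainType) (u : nat -> R * R * R) :
  positive u -> nondegenerate u -> signs u \in search 28.
Proof.
move=> up un; rewrite -[signs u](@take_size) size_signs; apply: search_complete.
  by rewrite size_signs.
rewrite clausesE all_map; apply/allP => s /(allP septuples_well_formed) wf.
exact: mixed_relation.
Qed.

Lemma dihedral_literals_ok : all (fun g =>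
  all (fun l : literal => (l.1 < 28)%N) (dihedral_literals g)) dihedral_index.
Proof. by vm_cast_no_check (erefl true). Qed.

Lemma signs_dihedral_map (R : realDomainType) (u : nat -> R * R * R) g :
  nondegenerate u -> g \in dihedral_index ->
  signs (u \o dihedral_map g) = dihedral_signs g (signs u).
Proof.
move=> un /(allP dihedral_literals_ok) ok.
rewrite /dihedral_signs /dihedral_literals -map_comp; apply/eq_in_map => s sin.
have /(value_literal_of un)[_ /= ->] : ((literal_of (map (dihedral_map g) s)).1 < 28)%N.
  by apply: (allP ok); exact: (map_f (fun t => literal_of (map (dihedral_map g) t))).
by congr (_ < 0); case: s {sin} => [|? [|? [|? [|? [|? [|? [|? ?]]]]]]].
Qed.

Lemma distinct_uniq n bs : all (fun b => size b == n) bs -> distinct n bs -> uniq bs.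
Proof.
elim: n bs => [|n IH] [|b [|c bs]] //; set s := [:: b, c & bs] => sz.
rewrite [distinct _ _]/= -/s => /andP[dt df].
have sub (P : pred (seq bool)) :
    all (fun b => size b == n) [seq behead b | b <- s & P b].
  apply/allP => _ /mapP[d + ->]; rewrite mem_filter => /andP[_ ds].
  by rewrite size_behead (eqP (allP sz _ ds)).
have ut := IH _ (sub _) dt; have uf := IH _ (sub _) df.
pose p : pred (seq bool) := head false.
have -> : uniq s = uniq ([seq d <- s | p d] ++ [seq d <- s | predC p d]).
  by apply: perm_uniq; rewrite perm_sym (permEl (perm_filterC p s)).
rewrite cat_uniq (map_uniq ut) (map_uniq uf) andbT andTb.
apply/hasPn => d; rewrite mem_filter => /andP[/negPf pd _].
have dn : d \notin [seq d <- s | p d] by rewrite mem_filter pd.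
exact: dn.
Qed.

(** * Convex position in homogeneous coordinates *)

Section Labels.
Local Open Scope nat_scope.

Definition labels_of (S : {set 'I_8}) : seq nat := [seq val i | i <- enum S].

Lemma enum_labels (S : {set 'I_8}) : enum S = [seq i <- enum 'I_8 | i \in S].
Proof. by rewrite enumT. Qed.

Lemma labels_of_subseq S : subseq (labels_of S) labels.
Proof.
by rewrite /labels_of /labels -val_enum_ord enum_labels; apply/map_subseq/filter_subseq.
Qed.

Lemma size_labels_of S : size (labels_of S) = #|S|.
Proof. by rewrite size_map cardE. Qed.

Lemma mem_labels_of S i : (val i \in labels_of S) = (i \in S).
Proof. by rewrite mem_map ?mem_enum //; exact: val_inj. Qed.

Lemma labels_of_set s : subseq s labels -> labels_of [set i : 'I_8 | val i \in s]%SET = s.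
Proof.
move=> ss; rewrite /labels_of; transitivity [seq x <- labels | x \in s].
  rewrite /labels -val_enum_ord filter_map; congr map.
  by rewrite enum_labels; apply: eq_filter => i; rewrite inE.
by apply/esym/subseq_uniqP.
Qed.

Lemma labels_sorted s : subseq s labels -> sorted ltn s.
Proof. by move=> ss; apply: (subseq_sorted ltn_trans ss); exact: iota_ltn_sorted. Qed.

Lemma labels_lt8 s x : subseq s labels -> x \in s -> x < 8.
Proof. by move=> /mem_subseq ss /ss; rewrite mem_iota. Qed.

End Labels.

Section Coordinates.
Variable R : realType.
Implicit Types (P : 'I_8 -> RP2 R) (u : nat -> R * R * R).

Definition row3 (x : R * R * R) : 'rV[R]_3 := vec3 x.1.1 x.1.2 x.2.

Lemma row3K x : coords3 (row3 x) = x.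
Proof. by rewrite /coords3 !vec3E; case: x => [[]]. Qed.

Lemma coords3K v : row3 (coords3 v) = v.
Proof. by rewrite /row3 /= -vec3_eta. Qed.

Definition coordinates P u := forall i : 'I_8,
  exists2 k, k != 0 & homog (P i) = k *: row3 (u i).

Lemma br_rot (a b c : R * R * R) : br b c a = br a b c.
Proof. by rewrite /br; ring. Qed.

Lemma positiveP u : reflect
  (forall i j k, (i < j)%N -> (j < k)%N -> (k < 8)%N -> 0 < br (u i) (u j) (u k))
  (positive u).
Proof.
apply: (iffP allP) => h.
  move=> i j k ij jk k8; apply: (h [:: i; j; k]).
  have : all (fun i => all (fun j => all (fun k => (i < j < k)%N ==>
    ([:: i; j; k] \in triangles)) labels) labels) labels by [].
  have l8 x : (x < 8)%N -> x \in labels by rewrite mem_iota.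
  move=> /allP/(_ i (l8 _ (ltn_trans ij (ltn_trans jk k8)))).
  move=> /allP/(_ j (l8 _ (ltn_trans jk k8))) /allP/(_ k (l8 _ k8)).
  by rewrite ij jk.
have ok : all (fun s => if s is [:: i; j; k] then [&& i < j, j < k & k < 8]%N else false)
   triangles by [].
move=> s /(allP ok); case: s => [|i [|j [|k [|//]]]] // /and3P[ij jk k8].
exact: h.
Qed.

(** Fix i.  The vectors u_j, taken modulo u_i, turn counterclockwise from one to the
    next and stay on one side of u_(i+1), so that they cannot make a full turn; the
    Pluecker relation turns this into an induction on k. *)
Lemma positive_chain u (n : nat) :
  (forall i j, (i.+1 < n)%N -> (j < n)%N -> j != i -> j != i.+1 ->
     0 < br (u i) (u i.+1) (u j)) ->
  forall i j k, (i < j)%N -> (j < k)%N -> (k < n)%N -> 0 < br (u i) (u j) (u k).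
Proof.
move=> side i j k ij jk kn.
have side' m : (i < m)%N -> (m.+1 < n)%N -> 0 < br (u i) (u m) (u m.+1).
  by move=> im mn; rewrite -br_rot; apply: side => //; lia.
have first m : (i.+1 < m)%N -> (m < n)%N -> 0 < br (u i) (u i.+1) (u m).
  by move=> im mn; apply: side => //; lia.
have [->|ij'] := eqVneq j i.+1; first by apply: first; lia.
elim: k jk kn => // k IH jk kn.
have [->|jk'] := eqVneq k j; first by apply: side'; lia.
have pk : 0 < br (u i) (u i.+1) (u k) by apply: first; lia.
rewrite -(pmulr_rgt0 _ pk).
have h1 : 0 < br (u i) (u i.+1) (u j) * br (u i) (u k) (u k.+1).
  by apply: mulr_gt0; [apply: first|apply: side']; lia.
have h2 : 0 < br (u i) (u i.+1) (u k.+1) * br (u i) (u j) (u k).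
  by apply: mulr_gt0; [apply: first|apply: IH]; lia.
rewrite (_ : _ * _ = br (u i) (u i.+1) (u j) * br (u i) (u k) (u k.+1) +
  br (u i) (u i.+1) (u k.+1) * br (u i) (u j) (u k)) ?addr_gt0 //.
apply/esym/eqP; rewrite -subr_eq0 addrAC; apply/eqP; exact: plucker.
Qed.

Lemma positive_side u (i j : 'I_8) : positive u -> j != i -> j != ordS i ->
  0 < br (u i) (u (ordS i)) (u j).
Proof.
move=> /positiveP up ji jS; have i8 := ltn_ord i; have j8 := ltn_ord j.
move: ji jS; rewrite -!val_eqE /=; set i' := (i.+1 %% 8)%N => ji jS.
have [i7|i7] := ltnP i 7.
  have e : i' = i.+1 by rewrite /i' modn_small.
  rewrite e in jS *; have [ij|ij] := ltnP j i; first by rewrite br_rot; apply: up; lia.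
  by apply: up; lia.
have vi : nat_of_ord i = 7%N by lia.
have e : i' = 0%N by rewrite /i' vi.
by rewrite e in jS *; rewrite -br_rot; apply: up; lia.
Qed.

Lemma linformE (l : 'cV[R]_3) x : linform l x = dot (homog x) l^T.
Proof. by rewrite /linform mxE sum_I3 /dot !mxE. Qed.

Lemma dot_row3_cross x y z : dot (row3 z) (cross x y) = br x y z.
Proof. by rewrite dot_cross row3K -br_rot. Qed.

(** If p and q are orthogonal to a, their cross product is the multiple of a by
    det(p, q, a) / |a|^2. *)
Lemma br_normal p q r (a : 'rV[R]_3) : dot (row3 p) a = 0 -> dot (row3 q) a = 0 ->
  dot a a * br p q r = br p q (coords3 a) * dot (row3 r) a.
Proof.
move=> pa qa.
transitivity (br p q (coords3 a) * dot (row3 r) a +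
   (dot (row3 p) a * br r (coords3 a) q - dot (row3 q) a * br r (coords3 a) p)).
  by rewrite /dot /br !vec3E /=; ring.
by rewrite pa qa; ring.
Qed.

(** The sides are given by the brackets [i, i+1, x].  The line at infinity
    [0, 1, x] + [2, 3, x] = 0 avoids all the points because each point is strictly
    on the positive side of one of the two lines and not on the negative side of
    the other. *)
Lemma convex_of_positive P u : coordinates P u -> positive u -> convex_position P.
Proof.
move=> Pu up; pose l := (cross (u 0) (u 1) + cross (u 2) (u 3))^T%N.
have side i j : (i < 7)%N -> (j < 8)%N -> 0 <= br (u i) (u i.+1) (u j).
  move=> i7 j8; have [->|ji] := eqVneq j i; first by rewrite /br; lra.
  have [->|jS] := eqVneq j i.+1; first by rewrite /br; lra.
  have [i8 iS8] : (i < 8)%N /\ (i.+1 < 8)%N by lia.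
  have := @positive_side u (Ordinal i8) (Ordinal j8) up ji.
  by rewrite -val_eqE /= modn_small // => /(_ jS)/ltW.
have l_gt0 (i : 'I_8) : 0 < br (u 0%N) (u 1%N) (u i) + br (u 2) (u 3) (u i).
  have i8 := ltn_ord i; have /positiveP up' := up.
  have [i2|i2] := ltnP i 2.
    apply: ltr_wpDl; first exact: side.
    by rewrite br_rot; apply: up'; lia.
  apply: ltr_pwDl; last exact: side.
  by apply: up'; lia.
have lE i : exists2 k, k != 0 & forall a,
    linform a (P i) = k * dot (row3 (u i)) a^T.
  by have [k k0 e] := Pu i; exists k => // a; rewrite linformE e dotZl.
have ll i : dot (row3 (u i)) l^T = br (u 0%N) (u 1%N) (u i) + br (u 2) (u 3) (u i).
  by rewrite /l trmxK -!dot_row3_cross /dot !mxE; ring.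
have l_neq0 (i : 'I_8) : linform l (P i) != 0.
  have [k k0 ->] := lE i; rewrite ll mulf_neq0 // gt_eqF //; exact: l_gt0.
exists l; split.
  by apply: contraNneq (l_neq0 0) => ->; rewrite linformE trmx0 /dot !mxE !mulr0 !addr0.
split; first by move=> i; apply/eqP.
move=> i; exists (cross (u i) (u (ordS i)))^T; split.
- have [k k0 ->] := lE i; rewrite trmxK dot_row3_cross /br; ring.
- have [k k0 ->] := lE (ordS i); rewrite trmxK dot_row3_cross /br; ring.
move=> j ji jS; have [k k0 E] := lE j.
rewrite !E trmxK dot_row3_cross ll -mulf_div divff // mul1r.
by apply: divr_gt0; [exact: positive_side|exact: l_gt0].
Qed.

(** The affine coordinates w have brackets [i, i+1, j] of one sign for each side i, and
    consecutive sides share the bracket [i, i+1, i+2], so this sign is the same for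
    all sides; multiplying all vectors by one bracket makes it positive. *)
Lemma positive_of_convex P : convex_position P ->
  exists2 u, coordinates P u & positive u.
Proof.
move=> [l [_ [lP sides]]].
pose w (n : nat) : R * R * R :=
  coords3 ((linform l (P (inord n)))^-1 *: homog (P (inord n))).
have l0 i : linform l (P i) != 0 by apply/eqP/lP.
have wE n a : dot (row3 (w n)) a^T = linform a (P (inord n)) / linform l (P (inord n)).
  by rewrite /w coords3K dotZl -linformE mulrC.
have wl n : dot (row3 (w n)) l^T = 1 by rewrite wE divff.
have inordS n : (n.+1 < 8)%N -> ordS (inord n : 'I_8) = inord n.+1.
  move=> n8; apply: val_inj; rewrite /= !inordK ?modn_small //; lia.
have inord_eq m n : (m < 8)%N -> (n < 8)%N -> (inord m == inord n :> 'I_8) = (m == n).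
  by move=> m8 n8; rewrite -val_eqE /= !inordK.
have side n : (n.+1 < 8)%N -> exists a : 'rV[R]_3,
    [/\ a != 0, dot (row3 (w n)) a = 0, dot (row3 (w n.+1)) a = 0 &
     forall j, (j < 8)%N -> j != n -> j != n.+1 -> 0 < dot (row3 (w j)) a].
  move=> n8; have [a [a1 a2 apos]] := sides (inord n).
  rewrite inordS // in a2 apos.
  have pos j : (j < 8)%N -> j != n -> j != n.+1 -> 0 < dot (row3 (w j)) a^T.
    by move=> j8 jn jS; rewrite wE; apply: apos; rewrite inord_eq //; lia.
  exists a^T; split; rewrite ?wE ?a1 ?a2 ?mul0r //.
  pose j := if (n < 4)%N then 7 else 0%N.
  have : 0 < dot (row3 (w j)) a^T by apply: pos; rewrite /j; case: ifP; lia.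
  by apply: contraTneq => ->; rewrite /dot !mxE !mulr0 !addr0 ltxx.
pose s := br (w 0%N) (w 1%N) (w 2).
(* If s vanished, so would [0, 1, x] for all x.  The vector c = b x l, where b is
   the side through w 1 and w 2 and l the line at infinity, shows that it does not:
   [0, 1, c] = (w 0 . b) (w 1 . l) - (w 0 . l) (w 1 . b) = (w 0 . b) > 0. *)
have s0 : s != 0.
  have [a [a0 e1 e2 apos]] := side 0%N isT; have [b [_ b1 _ bpos]] := side 1%N isT.
  apply/eqP => sz.
  have := br_normal (w 2) e1 e2; rewrite -/s sz mulr0 => /esym/eqP.
  rewrite mulf_eq0 orbC gt_eqF ?apos //= => /eqP z.
  pose c := cross (coords3 b) (coords3 l^T).
  have := br_normal (coords3 c) e1 e2; rewrite z mul0r => /eqP.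
  rewrite mulf_eq0 gt_eqF ?dot_gt0 //=.
  have -> : br (w 0%N) (w 1%N) (coords3 c) = dot (row3 (w 0%N)) b * dot (row3 (w 1%N)) l^T -
      dot (row3 (w 0%N)) l^T * dot (row3 (w 1%N)) b.
    by rewrite /br /c /cross /dot /coords3 !vec3E /=; ring.
  by rewrite !wl b1 mulr1 mulr0 subr0 gt_eqF // bpos.
have side_pos n j : (n.+1 < 8)%N -> (j < 8)%N -> j != n -> j != n.+1 ->
    0 < s * br (w n) (w n.+1) (w j).
  elim: n j => [|n IH] j n8 j8 jn jS; have [a [a0 e1 e2 apos]] := side _ n8;
    rewrite -(pmulr_rgt0 _ (dot_gt0 a0)) mulrCA (br_normal _ e1 e2) mulrA
      pmulr_lgt0 ?apos //.
    have sa : dot a a * s = br (w 0%N) (w 1%N) (coords3 a) * dot (row3 (w 2)) a.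
      exact: br_normal.
    rewrite -(pmulr_lgt0 _ (apos 2 isT isT isT)) -mulrA -sa mulrCA.
    by rewrite mulr_gt0 ?dot_gt0 // -expr2 exprn_even_gt0.
  have := IH n.+2; rewrite br_rot => /(_ _ _ _ _) pos.
  have an : 0 < dot (row3 (w n)) a by apply: apos; lia.
  rewrite -(pmulr_lgt0 _ an) -mulrA -(br_normal _ e1 e2) mulrCA.
  rewrite mulr_gt0 ?dot_gt0 //.
  by rewrite -br_rot -br_rot; apply: IH; lia.
(* Scaling by s multiplies the brackets by s ^ 3. *)
pose u n : R * R * R := coords3 (s *: row3 (w n)).
exists u.
  move=> i; exists (linform l (P i) / s).
    by rewrite mulf_neq0 // invr_eq0.
  rewrite /u coords3K /w coords3K inord_val !scalerA divfK // divff // scale1r //.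
apply/positiveP; apply: positive_chain => i j i8 j8 ji jS.
have -> : br (u i) (u i.+1) (u j) = s ^+ 2 * (s * br (w i) (w i.+1) (w j)).
  by rewrite /u /br /coords3 !mxE /=; ring.
by rewrite mulr_gt0 ?exprn_even_gt0 // side_pos.
Qed.
End Coordinates.

(** * Lists are sign patterns *)

(** The five labels on the conic come first, in increasing order, and the sixth point
    last: in this order a negative sign of [six] means inside. *)
Definition list_of_signs (b : seq bool) : plist :=
  [ffun x : query => value b (literal_of (rcons (labels_of (\val x).1) (val (\val x).2)))].

Section Lists.
Variable R : realType.
Implicit Types (P : 'I_8 -> RP2 R) (u : nat -> R * R * R).

Lemma qformZ (A : 'M[R]_3) k v : qform A (k *: v) = k ^+ 2 * qform A v.
Proof.
by rewrite /qform linearZ /= -!scalemxAl -scalemxAr !mxE mulrA expr2.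
Qed.

Section Coords.
Variables (P : 'I_8 -> RP2 R) (u : nat -> R * R * R).
Hypotheses (Pu : coordinates P u) (up : positive u).

Lemma conic_ofE A (i : 'I_8) : conic_of A (P i) <-> qform A (row3 (u i)) = 0.
Proof.
have [k k0 e] := Pu i.
rewrite (_ : conic_of A (P i) = (qform A (homog (P i)) = 0)) // e qformZ.
split=> [/eqP|->]; last by rewrite mulr0.
by rewrite mulf_eq0 expf_eq0 /= (negPf k0) => /eqP.
Qed.

Lemma on_labels A (s : seq nat) : (forall n, n \in s -> (n < 8)%N) ->
  (forall i : 'I_8, val i \in s -> conic_of A (P i)) ->
  forall n, n \in s -> qform A (row3 (u n)) = 0.
Proof.
move=> s8 ok n ns; have n8 := s8 n ns.
by have /conic_ofE := ok (Ordinal n8) ns.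
Qed.

Section FiveLabels.
Variables a b c d e : nat.
Hypothesis ss : subseq [:: a; b; c; d; e] labels.
Notation V n := (row3 (u n)).

Let ord : [/\ (a < b)%N, (b < c)%N, (c < d)%N, (d < e)%N & (e < 8)%N].
Proof.
have /= := labels_sorted ss; have e8 : (e < 8)%N.
  by apply: (labels_lt8 ss); rewrite !inE eqxx !orbT.
by rewrite andbT => /and4P[].
Qed.

Let pos i j k : (i < j)%N -> (j < k)%N -> (k <= e)%N ->
  0 < br (coords3 (V i)) (coords3 (V j)) (coords3 (V k)).
Proof.
move=> ij jk ke; rewrite !row3K; move/positiveP: up; apply=> //.
by have [_ _ _ _ e8] := ord; exact: leq_ltn_trans ke e8.
Qed.

Let posE i j k : (i < j)%N && (j < k)%N && (k <= e)%N ->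
  0 < br (coords3 (V i)) (coords3 (V j)) (coords3 (V k)).
Proof. by move=> /andP[/andP[]]; exact: pos. Qed.

Lemma five_labelsE v : five (V a) (V b) (V c) (V d) (V e) v =
  six (u a) (u b) (u c) (u d) (u e) (coords3 v).
Proof. by rewrite /five !row3K. Qed.

Definition through A := forall n, n \in [:: a; b; c; d; e] -> qform A (V n) = 0.

Lemma inside_labels A x : A^T = A -> A != 0 -> through A ->
  inside (conic_of A) x <-> six (u a) (u b) (u c) (u d) (u e) (coords3 (homog x)) < 0.
Proof.
move=> As A0 t; have [ab bc cd de _] := ord.
rewrite -five_labelsE; apply: inside_through_five => //;
  by [apply: posE; lia | apply: t; rewrite !inE eqxx ?orbT].
Qed.

Lemma qform_labels A : A^T = A -> A != 0 -> through A ->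
  exists2 k, k != 0 & forall v,
    qform A v = k * six (u a) (u b) (u c) (u d) (u e) (coords3 v).
Proof.
move=> As A0 t; have [ab bc cd de _] := ord.
have [k k0 kE] : exists2 k, k != 0 &
    forall v, qform A v = k * five (V a) (V b) (V c) (V d) (V e) v.
  by apply: qform_through_five => //;
    by [apply: posE; lia | apply: t; rewrite !inE eqxx ?orbT].
by exists k => // v; rewrite kE five_labelsE.
Qed.

Lemma exists_labels : exists A : 'M[R]_3,
  [/\ A^T = A, A != 0, forall v, qform A v = six (u a) (u b) (u c) (u d) (u e) (coords3 v)
    & through A].
Proof.
have [ab bc cd de _] := ord.
have [A [As A0 AE]] : exists A, [/\ A^T = A, A != 0 &
    forall v, qform A v = five (V a) (V b) (V c) (V d) (V e) v].
  by apply: exists_conic_through_five; apply: posE; lia.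
have AE' v : qform A v = six (u a) (u b) (u c) (u d) (u e) (coords3 v).
  by rewrite AE five_labelsE.
exists A; split=> // n; rewrite !inE AE' row3K /six /br.
by do ![case/orP] => /eqP ->; ring.
Qed.

End FiveLabels.

(** Five increasing labels and a sixth one form, after sorting, one of the 28 tuples. *)
Lemma query_literals_ok : all (fun s => all (fun p => (p \notin s) ==>
  ((literal_of (rcons s p)).1 < 28)%N) labels) (subseqs 5 labels).
Proof. by vm_cast_no_check (erefl true). Qed.

(** The homogeneous coordinates chosen by [homog] may have any sign, but [six] is of
    degree 2 in each point. *)
Lemma list_ofE : nondegenerate u -> list_of P = list_of_signs (signs u).
Proof.
move=> un; apply/ffunP => -[[S p] xP]; rewrite !ffunE /=.
have /andP[/eqP S5 pS] := xP; rewrite /= in S5 pS.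
have ss := labels_of_subseq S; have sz := size_labels_of S; rewrite S5 in sz.
have pl : val p \notin labels_of S by rewrite mem_labels_of.
have lt28 : ((literal_of (rcons (labels_of S) (val p))).1 < 28)%N.
  have sin : labels_of S \in subseqs 5 labels by have := mem_subseqs ss; rewrite sz.
  have /allP := allP query_literals_ok _ sin.
  move=> /(_ (val p)); rewrite mem_iota ltn_ord => /(_ isT) /implyP; exact.
have [_ ->] := value_literal_of un lt28.
have memS i : (i \in S) = (val i \in labels_of S) by rewrite mem_labels_of.
case: (labels_of S) ss sz memS {lt28 pl} => [|a [|b [|c [|d [|e [|//]]]]]] // ss _ memS.
have s8 n : n \in [:: a; b; c; d; e] -> (n < 8)%N by exact: labels_lt8.
have sixP : (six (u a) (u b) (u c) (u d) (u e) (coords3 (homog (P p))) < 0) =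
    (six_at u [:: a; b; c; d; e; val p] < 0).
  have [k k0 ->] := Pu p.
  rewrite (_ : six _ _ _ _ _ _ = k ^+ 2 * six_at u [:: a; b; c; d; e; val p]).
    by rewrite pmulr_rlt0 // exprn_even_gt0.
  by rewrite /= /six /br /coords3 /row3 !mxE /=; ring.
rewrite -sixP; apply/asboolP/idP.
  move=> [C [[A [As A0 ->]] CS]].
  have tA : through a b c d e A by apply: on_labels => // i; rewrite -memS; exact: CS.
  by move/(inside_labels ss _ As A0 tA).
have [A [As A0 AE tA]] := exists_labels ss.
move=> neg; exists (conic_of A); split.
- by exists A.
- by move=> i; rewrite memS => iS; apply/conic_ofE/tA.
- exact/(inside_labels ss _ As A0 tA).
Qed.

Lemma sextuplesE : sextuples = subseqs 6 labels.
Proof. by vm_cast_no_check (erefl sextuples). Qed.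

Lemma subseqsP (T : eqType) k (s t : seq T) :
  t \in subseqs k s -> subseq t s /\ size t = k.
Proof.
elim: s k t => [|x s IH] [|k] t //=; rewrite ?inE.
- by move/eqP->.
- by move/eqP->.
rewrite mem_cat => /orP[/mapP[r /IH[rs rk] ->]|/IH[ts tk]].
  by rewrite /= eqxx rk.
by split=> //; exact: subseq_trans ts (subseq_cons s x).
Qed.

Lemma genericP : generic P <-> nondegenerate u.
Proof.
split=> [gP|un].
  apply/allP => s; rewrite sextuplesE => /subseqsP[ss s6].
  case: s ss s6 => [|a [|b [|c [|d [|e [|f [|//]]]]]]] // ss _.
  have ss5 : subseq [:: a; b; c; d; e] labels.
    by apply: subseq_trans ss; exact: (prefix_subseq [:: a; b; c; d; e] [:: f]).
  have [A [As A0 AE tA]] := exists_labels ss5.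
  apply/eqP => /= z.
  pose S := [set i : 'I_8 | val i \in [:: a; b; c; d; e; f]]%SET.
  apply: (gP (conic_of A) S); first by exists A.
    by rewrite -size_labels_of labels_of_set.
  move=> i; rewrite inE => ni; apply/conic_ofE.
  have [<-|nf] := eqVneq f (val i); first by rewrite AE row3K.
  apply: tA; move: ni; rewrite !inE !orbA => /orP[//|/eqP e'].
  by rewrite e' eqxx in nf.
move=> C S [A [As A0 ->]] S6 on.
have ss := labels_of_subseq S; have sz := size_labels_of S; rewrite S6 in sz.
have sx : labels_of S \in sextuples.
  by rewrite sextuplesE; have := mem_subseqs ss; rewrite sz.
have {}on : forall i : 'I_8, val i \in labels_of S -> conic_of A (P i).
  by move=> i; rewrite mem_labels_of; exact: on.
have := allP un _ sx; move: on ss sz {sx}.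
case: (labels_of S) => [|a [|b [|c [|d [|e [|f [|//]]]]]]] // on ss _ /= six0.
have s8 n : n \in [:: a; b; c; d; e; f] -> (n < 8)%N by exact: labels_lt8.
have z := on_labels s8 on.
have ss5 : subseq [:: a; b; c; d; e] labels.
  by apply: subseq_trans ss; exact: (prefix_subseq [:: a; b; c; d; e] [:: f]).
have tA : through a b c d e A.
  by move=> n nin; apply: z; rewrite (mem_subseq (prefix_subseq _ [:: f]) nin).
have [k k0 kE] := qform_labels ss5 As A0 tA.
have := z f; rewrite kE row3K !inE eqxx !orbT => /(_ isT)/eqP.
by rewrite mulf_eq0 (negPf k0) (negPf six0).
Qed.
End Coords.
End Lists.

(** * Relabelling, forty-seven octagons, and the count *)

Section Realized.
Variable R : realType.
Implicit Types (P : 'I_8 -> RP2 R) (u : nat -> R * R * R).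

Lemma positive_realizable u : positive u -> exists P, coordinates P u.
Proof.
move=> up.
have nz (i : 'I_8) : row3 (u i) != 0.
  have [j ji jS] : exists2 j : 'I_8, j != i & j != ordS i.
    by exists (ordS (ordS i)); rewrite -val_eqE /=; have := ltn_ord i; lia.
  have := positive_side up ji jS; rewrite -br_rot -dot_row3_cross.
  by apply: contraTneq => ->; rewrite /dot !mxE !mul0r !addr0 ltxx.
exists (fun i => proj_point (nz i)) => i; exact: homog_proj_point.
Qed.

Lemma realizedP L : reflect
  (exists u, [/\ positive u, nondegenerate u & L = list_of_signs (signs u)])
  (L \in realized R).
Proof.
rewrite inE; apply: (iffP (asboolP _)).
  move=> [P [/positive_of_convex[u Pu up] gP <-]].
  have un : nondegenerate u by apply/(genericP Pu up).
  by exists u; split=> //; exact: list_ofE.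
move=> [u [up un ->]]; have [P Pu] := positive_realizable up.
exists P; split; first exact: convex_of_positive Pu up.
  exact/(genericP Pu up).
exact: list_ofE.
Qed.

(** From here on only the number of possible patterns matters. *)
Lemma finitely_many_signs : exists2 S : seq (seq bool), size S = 752%N &
  forall u, positive u -> nondegenerate u -> signs u \in S.
Proof. exists (search 28); [exact: size_search|move=> u; exact: signs_search]. Qed.

Lemma card_realized_le : (#|realized R| <= 752)%N.
Proof.
have [S <- bS] := finitely_many_signs.
apply: (@leq_trans #|[set L in map list_of_signs S]%SET|).
  apply/subset_leq_card/fintype.subsetP => L /realizedP[u [up un ->]].
  by rewrite inE; apply/map_f/bS.
by rewrite cardsE; apply: leq_trans (card_size _) _; rewrite size_map.
Qed.

Definition neg u (n : nat) : R * R * R := (- (u n).1.1, - (u n).1.2, - (u n).2).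

(** A reflection reverses the orientation of the octagon; changing the sign of all
    vectors makes the increasing brackets positive again and does not affect [six]. *)
Definition relabeled_coord (g : bool * nat) u : nat -> R * R * R :=
  if g.1 then neg (u \o dihedral_map g) else u \o dihedral_map g.

Lemma six_at_relabeled g u s :
  six_at (relabeled_coord g u) s = six_at (u \o dihedral_map g) s.
Proof.
rewrite /relabeled_coord; case: (g.1) => //.
case: s => [|? [|? [|? [|? [|? [|? [|? ?]]]]]]] //=; rewrite /six /br /neg /=; ring.
Qed.

Lemma dihedral_map_triangles : all (fun g => all (fun s =>
  ((sort_sign (map (dihedral_map g) s)).1 == g.1) &&
  ((sort_sign (map (dihedral_map g) s)).2 \in triangles)) triangles) dihedral_index.
Proof. by vm_cast_no_check (erefl true). Qed.

Lemma positive_relabeled g u : g \in dihedral_index -> positive u ->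
  positive (relabeled_coord g u).
Proof.
move=> /(allP dihedral_map_triangles)/allP ok up; apply/allP => s sin.
have /andP[/eqP sg mem] := ok s sin.
have [n0 lt0] : br_at (u \o dihedral_map g) s != 0 /\
    (br_at (u \o dihedral_map g) s < 0) = g.1.
  have : all (fun s => size s == 3) triangles by [].
  move=> /allP/(_ s sin); case: s sg mem {sin} => [|i [|j [|k [|//]]]] // sg mem _.
  by have [? ->] := odd3E up mem; split=> //; rewrite -sg.
rewrite /relabeled_coord; case: ifP lt0 => _ lt0.
  suff -> : br_at (neg (u \o dihedral_map g)) s = - br_at (u \o dihedral_map g) s.
    by rewrite oppr_gt0.
  case: s {sin sg mem n0 lt0} => [|i [|j [|k [|? ?]]]] /=; rewrite ?oppr0 //.
  by rewrite /br /neg /=; ring.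
by rewrite lt_def n0 leNgt lt0.
Qed.

Lemma nondegenerate_relabeled g u : g \in dihedral_index -> nondegenerate u ->
  nondegenerate (relabeled_coord g u).
Proof.
move=> gd un; apply/allP => s sin; rewrite six_at_relabeled.
have : ((literal_of (map (dihedral_map g) s)).1 < 28)%N.
  apply: (allP (allP dihedral_literals_ok _ gd)).
  exact: (map_f (fun t => literal_of (map (dihedral_map g) t))).
move=> /(value_literal_of un)[+ _].
by case: s {sin} => [|? [|? [|? [|? [|? [|? [|? ?]]]]]]].
Qed.

Lemma signs_relabeled g u : g \in dihedral_index -> nondegenerate u ->
  signs (relabeled_coord g u) = dihedral_signs g (signs u).
Proof.
move=> gd un; rewrite -signs_dihedral_map //.
by apply: eq_map => s; rewrite six_at_relabeled.
Qed.

Lemma relabel_list_of P (s : 'S_8) :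
  list_of (fun i => P (s i)) = relabel (list_of P) s^-1%g.
Proof.
apply/ffunP => x; rewrite !ffunE invgK /=.
apply/asboolP/asboolP => -[C [Cc CS Cp]]; exists C; split=> //.
  by move=> _ /imsetP[i iS ->]; exact: CS.
by move=> i iS; apply: CS; rewrite imset_f.
Qed.

Lemma relabel_list_of_signs u g (s : 'S_8) :
  positive u -> nondegenerate u -> g \in dihedral_index ->
  (forall i, s i = dihedral_map g i :> nat) ->
  list_of_signs (dihedral_signs g (signs u)) = relabel (list_of_signs (signs u)) s^-1%g.
Proof.
move=> up un gd sg; have [P Pu] := positive_realizable up.
rewrite -(list_ofE Pu up un) -relabel_list_of -signs_relabeled //.
apply/esym/list_ofE; [| exact: positive_relabeled | exact: nondegenerate_relabeled].
move=> i; have [k k0 e] := Pu (s i).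
rewrite /relabeled_coord /neg /=; case: (g.1).
  exists (- k); rewrite ?oppr_eq0 // e sg.
  by apply: row3_eq; rewrite !mxE /=; ring.
by exists k => //; rewrite e sg.
Qed.

End Realized.

Section Dihedral.
Local Open Scope group_scope.

Let r : 'S_8 := perm (can_inj (@ordSK 8)).
Let f : 'S_8 := perm (@rev_ord_inj 8).

Let rX k (i : 'I_8) : (r ^+ k) i = ((i + k) %% 8)%N :> nat.
Proof.
elim: k => [|k IH]; first by rewrite expg0 perm1 addn0 modn_small.
by rewrite expgSr permM permE /= IH; lia.
Qed.

Let fE (i : 'I_8) : f i = (7 - i)%N :> nat.
Proof. by rewrite permE /=; lia. Qed.

Lemma dihedral_perm g : g \in dihedral_index ->
  exists2 s : 'S_8, s \in D8 & forall i, s i = dihedral_map g i :> nat.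
Proof.
case: g => e k _; exists (f ^+ e * r ^+ k).
  by rewrite groupM ?groupX // mem_gen // !inE eqxx ?orbT.
move=> i; rewrite permM rX /dihedral_map /=; case: e => /=.
  by rewrite expg1 fE.
by rewrite expg0 perm1.
Qed.

(** The reflection inverts the rotation, so the group is the product of the two cyclic
    groups. *)
Lemma card_D8_le : (#|D8| <= 16)%N.
Proof.
have r8 : r ^+ 8 = 1.
  by apply/permP => i; apply: ord_inj; rewrite rX perm1 modnDr modn_small.
have f2 : f ^+ 2 = 1.
  apply/permP => i; apply: ord_inj; rewrite expgS expg1 permM !fE perm1.
  by have := ltn_ord i; lia.
have rfr : r * f * r = f.
  apply/permP => i; apply: ord_inj; rewrite !permM -[r]expg1 rX !fE rX.
  by have := ltn_ord i; lia.
have rf : r ^ f = r^-1.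
  by apply: (mulIg r); rewrite mulVg conjgE -mulgA rfr mulVg.
have D8E : D8 = <[r]> * <[f]> :> {set 'S_8}.
  rewrite -norm_joinEr ?norms_cycle ?cycle_subG ?norms_cycle ?rf ?groupV ?cycle_id //.
  by rewrite /= joing_idl joing_idr.
have := mul_cardG <[r]> <[f]>; rewrite -D8E => e.
apply: (@leq_trans (#|<[r]>| * #|<[f]>|)%N).
  by rewrite e leq_pmulr // cardG_gt0.
by rewrite (@leq_mul _ _ 8 2) // dvdn_leq // order_dvdn ?r8 ?f2.
Qed.
End Dihedral.

(** Each of the 28 signs is itself an entry of the list, with the largest label as the
    sixth point. *)
Lemma list_of_signs_inj b b' : size b = 28%N -> size b' = 28%N ->
  list_of_signs b = list_of_signs b' -> b = b'.
Proof.
move=> sb sb' e; apply: (@eq_from_nth _ false); rewrite ?sb ?sb' // => i i28.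
pose s := nth [::] sextuples i.
have sin : s \in sextuples by rewrite mem_nth.
have own : all (fun s => [&& subseq (take 5 s) labels, size (take 5 s) == 5%N,
    nth 0%N s 5 \in labels, nth 0%N s 5 \notin take 5 s &
    literal_of (rcons (take 5 s) (nth 0%N s 5)) == (index s sextuples, false)]) sextuples.
  by vm_compute.
have /and5P[ss /eqP s5 pl pn /eqP lE] := allP own _ sin.
pose S := [set j : 'I_8 | val j \in take 5 s]%SET.
pose p : 'I_8 := inord (nth 0%N s 5).
have pE : val p = nth 0%N s 5 by apply: inordK; move: pl; rewrite mem_iota.
have qP : (#|S| == 5%N) && (p \notin S).
  by rewrite -size_labels_of labels_of_set // s5 eqxx /= inE pE.
have idx : index s sextuples = i by rewrite index_uniq.
rewrite idx in lE.
have := congr1 (fun L : plist => L (exist _ (S, p) qP)) e.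
by rewrite !ffunE /= labels_of_set // pE lE.
Qed.

Section Transfer.
Variable R : realType.

Definition ofZ (z : Z) : R := (int_of_Z z)%:~R.

Lemma ofZ_lt0 z : (ofZ z < 0) = (z < 0).
Proof. by rewrite /ofZ ltrz0; case: z. Qed.

Lemma ofZ_gt0 z : (0 < ofZ z) = (0 < z).
Proof. by rewrite /ofZ ltr0z; case: z => // p; rewrite /= ltz_nat; lia. Qed.

Lemma ofZ_eq0 z : (ofZ z == 0) = (z == 0).
Proof. by rewrite /ofZ intr_eq0 -(inj_eq (can_inj int_of_ZK)). Qed.

Definition ofZ3 (x : Z * Z * Z) : R * R * R := (ofZ x.1.1, ofZ x.1.2, ofZ x.2).

Lemma ofZD : {morph ofZ : x y / x + y}.
Proof. by move=> x y; rewrite /ofZ raddfD intrD. Qed.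

Lemma ofZB : {morph ofZ : x y / x - y}.
Proof. by move=> x y; rewrite /ofZ raddfB intrB. Qed.

Lemma ofZM : {morph ofZ : x y / x * y}.
Proof. by move=> x y; rewrite /ofZ rmorphM intrM. Qed.

Lemma br_ofZ x y z : br (ofZ3 x) (ofZ3 y) (ofZ3 z) = ofZ (br x y z).
Proof. by rewrite /br !(ofZB, ofZD, ofZM). Qed.

Lemma br_at_ofZ u s : br_at (ofZ3 \o u) s = ofZ (br_at u s).
Proof. by case: s => [|? [|? [|? [|? ?]]]] //; exact: br_ofZ. Qed.

Lemma six_at_ofZ u s : six_at (ofZ3 \o u) s = ofZ (six_at u s).
Proof.
case: s => [|? [|? [|? [|? [|? [|? [|? ?]]]]]]] //.
by rewrite /six_at /six !br_ofZ -!ofZM -ofZB.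
Qed.

Definition octagon_coordR c := ofZ3 \o octagon_coord c.

Lemma octagon_coordR_good c : c \in octagons ->
  positive (octagon_coordR c) /\ nondegenerate (octagon_coordR c).
Proof.
move=> /(allP octagons_good)/andP[/allP up /allP un].
split; apply/allP => s sin; first by rewrite br_at_ofZ ofZ_gt0 up.
by rewrite six_at_ofZ ofZ_eq0 un.
Qed.

Lemma signs_octagon_coordR c : signs (octagon_coordR c) = signs (octagon_coord c).
Proof. by apply: eq_map => s; rewrite six_at_ofZ ofZ_lt0. Qed.

Lemma mem_all_signs b : b \in all_signs -> exists c g,
  [/\ c \in octagons, g \in dihedral_index &
     b = dihedral_signs g (signs (octagon_coordR c))].
Proof.
move=> /flattenP[_ /mapP[c cin ->] /mapP[l /mapP[g gin ->] ->]].
by exists c, g; split; rewrite // signs_octagon_coordR.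
Qed.

Lemma size_all_signs : size all_signs = 752%N.
Proof. by vm_cast_no_check (erefl 752%N). Qed.

Lemma all_signs_size : all (fun b => size b == 28%N) all_signs.
Proof.
apply/allP => b /mem_all_signs[c [g [_ _ ->]]].
by rewrite /dihedral_signs /dihedral_literals !size_map.
Qed.

Definition lists := [seq list_of_signs b | b <- all_signs].

Lemma lists_uniq : uniq lists.
Proof.
rewrite map_inj_in_uniq; first exact: distinct_uniq all_signs_size all_signs_distinct.
move=> b b' /(allP all_signs_size)/eqP sb /(allP all_signs_size)/eqP sb'.
exact: list_of_signs_inj.
Qed.

Lemma lists_orbit L : L \in lists -> exists2 c, c \in octagons &
  L \in orbit relabel_action D8 (list_of_signs (signs (octagon_coordR c))).
Proof.
move=> /mapP[b /mem_all_signs[c [g [cin gin ->]]] ->]; exists c => //.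
have [up un] := octagon_coordR_good cin; have [s sD sg] := dihedral_perm gin.
by rewrite (relabel_list_of_signs up un gin sg); apply: mem_orbit; rewrite groupV.
Qed.

Lemma lists_realized : {subset lists <= realized R}.
Proof.
move=> _ /mapP[b /mem_all_signs[c [g [cin gin ->]]] ->].
have [up un] := octagon_coordR_good cin; apply/realizedP.
exists (relabeled_coord g (octagon_coordR c)); split; first exact: positive_relabeled.
  exact: nondegenerate_relabeled.
by rewrite signs_relabeled.
Qed.

Lemma card_lists : #|[set L in lists]%SET| = 752%N.
Proof. by rewrite cardsE (card_uniqP lists_uniq) size_map size_all_signs. Qed.

Lemma realizedE : realized R = [set L in lists]%SET.
Proof.
apply/esym/eqP; rewrite eqEcard card_lists card_realized_le andbT.
by apply/fintype.subsetP => L; rewrite finset.in_set; exact: lists_realized.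
Qed.

Let orbits := [set orbit relabel_action D8 L | L in realized R]%SET.

(** Every realized list is in the orbit of the list of one of the octagons. *)
Lemma card_orbits_le : (#|orbits| <= 47)%N.
Proof.
pose reps := [seq orbit relabel_action D8
  (list_of_signs (signs (octagon_coordR c))) | c <- octagons].
apply: (@leq_trans #|[set O in reps]%SET|); last first.
  by rewrite cardsE; apply: leq_trans (card_size _) _; rewrite size_map.
apply/subset_leq_card/fintype.subsetP => _ /imsetP[L + ->].
rewrite realizedE !finset.in_set => /lists_orbit[c cin Lc].
by apply/mapP; exists c => //; apply/orbit_eqP.
Qed.

(** The orbits cover 752 lists and none has more than 16 elements. *)
Lemma card_orbits_ge : (47 <= #|orbits|)%N.
Proof.
have cov : realized R \subset finset.cover orbits.
  apply/fintype.subsetP => L LR; apply/finset.bigcupP.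
  by exists (orbit relabel_action D8 L); rewrite ?imset_f ?orbit_refl.
have := leq_trans (subset_leq_card cov) (leq_card_cover _).
rewrite realizedE card_lists => h.
have {}h : (752 <= #|orbits| * 16)%N.
  apply: leq_trans h _; rewrite -sum_nat_const; apply: leq_sum => O /imsetP[L _ ->].
  by apply: leq_trans (leq_imset_card _ _) card_D8_le.
by rewrite -(@leq_pmul2r 16) //; apply: leq_trans h.
Qed.

End Transfer.

Theorem theorem2 (R : realType) :
  #|[set orbit relabel_action D8 L | L in realized R]%SET| = 47%N /\
  #|realized R| = 752%N.
Proof.
split; last by rewrite realizedE card_lists.
by apply/eqP; rewrite eqn_leq card_orbits_le card_orbits_ge.
Qed.
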